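(* Let $C$ be a nonempty convex subset of $X$, let $F\colon X\to Y\cup\{+\infty_Y\}$ be a proper $K$-convex mapping, and let $G\colon X\to Z\cup\{+\infty_Z\}$ be a proper $S$-convex mapping. Let $A:=C\cap G^{-1}(-S)$, $E:=G(C\cap\operatorname{dom}F\cap\operatorname{dom}G)+S$, and let $\bar x\in A\cap\operatorname{dom}F$. Assume that one of the following conditions holds: $(c_1)$ there exists $x_0\in C\cap\operatorname{dom}F$ such that $G(x_0)\in-\operatorname{int}S$; $(c_2)$ $X,Z$ are Fréchet spaces, $C$ is closed, $y^*\circ F$ is lower semicontinuous for all $y^*\in Y^*$, $G$ is $S$-epi closed and $0_Z\in\operatorname{sqri}E$; $(c_3)$ $\dim\operatorname{lin}E<+\infty$ and $0_Z\in\operatorname{ri}E$. Then both of the following hold: $(i)$ $\bar x$ is a weak solution of $(\mathrm{VOP})$ if and only if there exists $T\in\mathcal{L}_+^w(S,K)$ such that $$-F(\bar x)-I_{-S}^*(T)\subset(F+I_C+T\circ G)^*(0_{\mathcal{L}})+K.$$ $(j)$ $\bar x$ is a weak solution of $(\mathrm{VOP})$ if and only if there exists $T\in\mathcal{L}_+^w(S,K)$ such that $$F(x)+(T\circ G)(x)-F(\bar x)\notin T(-S)-\operatorname{int}K,\quad\forall x\in C.$$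
   Context: $X,Y,Z$ are (real) locally convex Hausdorff topological vector spaces with topological duals $X^*,Y^*,Z^*$; $K\subset Y$ is a closed, pointed, convex cone with $\operatorname{int}K\neq\emptyset$; $S\subset Z$ is a nonempty closed convex cone. Order and infinite elements: for $y_1,y_2\in Y$, $y_1<_K y_2$ means $y_1-y_2\in-\operatorname{int}K$. $Y^\bullet:=Y\cup\{-\infty_Y,+\infty_Y\}$, where $\pm\infty_Y\notin Y$ and $-\infty_Y<_K y<_K+\infty_Y$ for all $y\in Y$ (hence also $-\infty_Y<_K+\infty_Y$). Conventions: $-(+\infty_Y)=-\infty_Y$, $-(-\infty_Y)=+\infty_Y$, $(+\infty_Y)+y=y+(+\infty_Y)=+\infty_Y$ for $y\in Y\cup\{+\infty_Y\}$, $(-\infty_Y)+y=y+(-\infty_Y)=-\infty_Y$ for $y\in Y\cup\{-\infty_Y\}$. Analogous elements $\pm\infty_Z$ and conventions are used for $Z$ (ordered by $S$). Weak supremum/infimum: for $\emptyset\neq M\subset Y^\bullet$, $\operatorname{WSup}M$ is the set of $\bar v\in Y^\bullet$ such that $\bar v\not<_K v$ for all $v\in M$, and for every $\tilde v\in Y^\bullet$ with $\tilde v<_K\bar v$ there is $v\in M$ with $\tilde v<_K v$. $\operatorname{WInf}M$ is the set of $\bar v\in Y^\bullet$ such that $v\not<_K\bar v$ for all $v\in M$, and for every $\tilde v\in Y^\bullet$ with $\bar v<_K\tilde v$ there is $v\in M$ with $v<_K\tilde v$. $\operatorname{WMin}M=M\cap\operatorname{WInf}M$. $(\mathrm{VOP})$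 is the problem $\operatorname{WMin}\{F(x): x\in C,\ G(x)\in-S\}$, and $\bar x\in A$ is a weak solution of $(\mathrm{VOP})$ if $F(\bar x)\in\operatorname{WMin}F(A)$. Mappings: for $F\colon X\to Y^\bullet$, $\operatorname{dom}F=\{x\in X: F(x)\neq+\infty_Y\}$; $F$ is proper if $\operatorname{dom}F\neq\emptyset$ and $-\infty_Y\notin F(X)$; $\operatorname{epi}_KF=\{(x,y)\in X\times Y: y\in F(x)+K\}$; $F$ is $K$-convex if $\operatorname{epi}_KF$ is convex, and $K$-epi closed if it is closed. The same notions are used for $G$ with $(Z,S)$ in place of $(Y,K)$. For $y^*\in Y^*$, $(y^*\circ F)(x)=y^*(F(x))$ if $F(x)\in Y$ and $+\infty$ if $F(x)=+\infty_Y$. $\mathcal{L}(X,Y)$ is the space of continuous linear mappings $X\to Y$; $0_{\mathcal{L}}$ is its zero element. The conjugate of $F$ is the set-valued map $F^*(L)=\operatorname{WSup}\{L(x)-F(x):x\in X\}$, $L\in\mathcal{L}(X,Y)$. For a set $D$ in $X$ (or in $Z$), $I_D(x)=0_Y$ if $x\in D$ and $I_D(x)=+\infty_Y$ otherwise; in particular, for $-S\subset Z$ and $T\in\mathcal{L}(Z,Y)$, $I_{-S}^*(T)=\operatorname{WSup}T(-S)$. For $T\in\mathcal{L}(Z,Y)$, $(T\circ G)(x)=T(G(x))$ if $G(x)\in Z$ and $+\infty_Y$ if $G(x)=+\infty_Z$. $\mathcal{L}_+^w(S,K)=\{T\in\mathcal{L}(Z,Y): T(S)\cap(-\operatorname{int}K)=\emptyset\}$.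 For a convex set $U$: $\operatorname{lin}U$ is its linear hull, $\operatorname{ri}U$ its relative interior (interior relative to its affine hull), and $\operatorname{sqri}U$ its strong quasi-relative interior, i.e. the set of $u\in U$ such that the cone $\bigcup_{\lambda\ge 0}\lambda(U-u)$ is a closed linear subspace. *)

(* Defs.v *)
From HB Require Import structures.
From mathcomp Require Import all_boot all_order all_algebra.
From mathcomp Require Import all_classical all_reals all_analysis.

Set Implicit Arguments.
Unset Strict Implicit.
Unset Printing Implicit Defensive.

Import Order.TTheory GRing.Theory Num.Theory.
Import numFieldNormedType.Exports.

Local Open Scope classical_set_scope.
Local Open Scope ring_scope.

Inductive augmented (V : Type) : Type := Fin of V | PInf | NInf.
Arguments Fin {V} _.
Arguments PInf {V}.
Arguments NInf {V}.

Declare Scope augmented_scope.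
Delimit Scope augmented_scope with X.
Bind Scope augmented_scope with augmented.

Section AugmentedArithmetic.
Context {V : zmodType}.
Implicit Types u v : augmented V.

Definition eopp u : augmented V :=
  match u with Fin a => Fin (- a) | PInf => NInf | NInf => PInf end.

(* The sum of two opposite infinities is meant to be left undefined; the value
   PInf given to it here is immaterial, as such sums are never formed below. *)
Definition eadd u v : augmented V :=
  match u, v with
  | Fin a, Fin b => Fin (a + b)
  | NInf, NInf | NInf, Fin _ | Fin _, NInf => NInf
  | _, _ => PInf
  end.

Definition eadd_set (A B : set (augmented V)) : set (augmented V) :=
  [set eadd u v | u in A & v in B].

End AugmentedArithmetic.

Notation "- u" := (eopp u) : augmented_scope.
Notation "u + v" := (eadd u v) : augmented_scope.
Notation "u - v" := (eadd u (eopp v)) : augmented_scope.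

Section Sets.
Context {R : realType} {V : tvsType R}.
Implicit Types U W : set V.

Definition opp_set U : set V := [set - v | v in U].

Definition is_cone U := forall (t : R) v, 0 <= t -> U v -> U (t *: v).

Definition pointed_cone U := U `&` opp_set U = [set 0].

Definition is_subspace W :=
  W 0 /\ forall (t : R) u v, W u -> W v -> W (t *: u + v).

Definition is_affine W :=
  forall (t : R) u v, W u -> W v -> W (t *: u + (1 - t) *: v).

Definition lin U : set V := smallest is_subspace U.

Definition aff U : set V := smallest is_affine U.

Definition finite_dim W := exists s : seq V, W = lin [set` s].

Definition ri U : set V := [set u | U u /\ within (aff U) (nbhs u) U].

Definition cone_at U (u : V) : set V :=
  [set t *: (v - u) | t in [set t : R | 0 <= t] & v in U].

Definition sqri U : set V :=
  [set u | [/\ U u, is_subspace (cone_at U u) & closed (cone_at U u)]].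

End Sets.

(* A tvsType carries a uniformity inducing its topology, but this uniformity is
   not required to be translation invariant; completeness is therefore expressed
   with a translation-invariant metric instead of the uniform structure. *)
Definition frechet_space (R : realType) (V : tvsType R) : Prop :=
  exists d : V -> V -> R,
    [/\ forall x y, 0 <= d x y /\ (d x y = 0 <-> x = y),
        forall x y, d x y = d y x,
        forall x y z, d x z <= d x y + d y z &
        forall x y z, d (x + z) (y + z) = d x y] /\
    [/\ forall x (U : set V),
          nbhs x U <-> exists2 e : R, 0 < e & [set y | d x y < e] `<=` U &
        forall u : nat -> V,
          (forall e : R, 0 < e -> exists N, forall m n,
             (N <= m)%N -> (N <= n)%N -> d (u m) (u n) < e) ->
          exists l : V, u @ \oo --> l].

Record continuous_linear (R : realType) (V W : tvsType R) := ContinuousLinear {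
  clin_fun :> {linear V -> W};
  clin_continuous : continuous clin_fun }.

Section ZeroMap.
Context {R : realType} {V W : tvsType R}.

Lemma null_fun_continuous : continuous (\0 : {linear V -> W}).
Proof. by move=> x; exact: cvg_cst. Qed.

Definition clin0 : continuous_linear V W :=
  ContinuousLinear null_fun_continuous.

End ZeroMap.

Section WeakOrder.
Context {R : realType} {Y : tvsType R} (K : set Y).
Implicit Types (M : set (augmented Y)) (u v : augmented Y).

Definition wlt u v : Prop :=
  match u, v with
  | Fin a, Fin b => opp_set (K°) (a - b)
  | NInf, Fin _ | NInf, PInf | Fin _, PInf => True
  | _, _ => False
  end.

(* WSup and WInf are only meant for nonempty sets. *)
Definition WSup M : set (augmented Y) :=
  [set v | (forall u, M u -> ~ wlt v u) /\
           (forall w, wlt w v -> exists2 u, M u & wlt w u)].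

Definition WInf M : set (augmented Y) :=
  [set v | (forall u, M u -> ~ wlt u v) /\
           (forall w, wlt v w -> exists2 u, M u & wlt u w)].

Definition WMin M : set (augmented Y) := M `&` WInf M.

End WeakOrder.

Section Mappings.
Context {R : realType} {V W : tvsType R}.
Implicit Types (D : set V) (K : set W) (F : V -> augmented W).

Definition edom F : set V := [set x | F x <> PInf].

Definition proper_map F := edom F !=set0 /\ ~ range F NInf.

Definition epi K F : set (V * W) :=
  [set p | eadd_set [set F p.1] (Fin @` K) (Fin p.2)].

Definition cone_convex K F := convex_set (epi K F).

Definition epi_closed K F := closed (epi K F).

Definition indicator D (x : V) : augmented W :=
  if x \in D then Fin 0 else PInf.

Definition conjugate K F (L : continuous_linear V W) : set (augmented W) :=
  WSup K (range (fun x => Fin (L x) - F x)%X).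

End Mappings.

(* The compositions below are meant for mappings that never take the value
   NInf. *)
Definition comp_dual (R : realType) (X Y : tvsType R)
    (y : continuous_linear Y R^o) (F : X -> augmented Y) (x : X) : \bar R :=
  if F x is Fin v then (y v)%:E else +oo%E.

Definition comp_clin (R : realType) (X Y Z : tvsType R)
    (T : continuous_linear Z Y) (G : X -> augmented Z) (x : X) : augmented Y :=
  if G x is Fin z then Fin (T z) else PInf.

Definition Lplusw (R : realType) (Y Z : tvsType R) (S : set Z) (K : set Y) :
    set (continuous_linear Z Y) :=
  [set T | (T @` S) `&` opp_set (K°) = set0].

Section Problem.
Context {R : realType} {X Y Z : tvsType R}.
Variables (K : set Y) (S : set Z) (C : set X).
Variables (F : X -> augmented Y) (G : X -> augmented Z).

Definition feasible : set X := C `&` G @^-1` (Fin @` opp_set S).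

Definition weak_solution (x : X) := feasible x /\ WMin K (F @` feasible) (F x).

(* The set G(C `&` dom F `&` dom G) + S, seen as a subset of Z: it contains no
   infinite element when G never takes the value NInf. *)
Definition value_set : set Z :=
  [set z |
    eadd_set (G @` (C `&` edom F `&` edom G)) (Fin @` S) (Fin z)].

End Problem.

(* Main.v *)
Require Import Defs.
From HB Require Import structures.
From mathcomp Require Import all_boot all_order all_algebra.
From mathcomp Require Import all_classical all_reals all_analysis.
From mathcomp Require Import lra.

(** A multiplier exists because the vector problem can be scalarized and because
    the scalar problem obtained in this way has a convex value function with a
    continuous subgradient at [0].

    Write [vbar] for [F xbar]. For a fixed [T] in [Lplusw S K], both conditions
    of the theorem say that [T (- s) - (F x + T (G x) - vbar)] is never interior
    to [K], for [x] in [C] and [s] in [S]; this is [weak_lagrangian]. For the pointwise condition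
    it is immediate. For the inclusion of conjugates it holds because every line
    directed by an interior point of [K] meets the weak supremum of a bounded set
    ([WSup_on_line]), so that a weak supremum, enlarged by [K], is determined by
    the points lying strictly below some element of the set
    ([weak_lagrangian_conjugate]). Sufficiency is then the choice [s = - G x]
    for a feasible [x].

    For necessity, the convex set of the differences [w - vbar], where [w] is
    above [F x] for a feasible [x], misses [- int K]. A continuous functional [y]
    separates them ([weak_separation]), so [xbar] minimizes [y \o F] over the
    feasible points ([scalarization]). The value function
      [phi z = inf {y (F x) - y vbar | x in C, G x - z in - S}]
    is convex, vanishes at [0], and its domain is the set [E] to which the
    constraint qualifications refer. If [l] is a continuous functional below
    [phi], then [T z = - l z *: e], with [e] interior to [K] and [y e = 1], is a
    multiplier ([multiplier_weak_lagrangian]).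

    Each qualification provides such an [l]. A convex function bounded above
    near [0], in a subspace containing its domain, has a continuous subgradient
    at [0] ([subgradient_of_bounded]). A Slater point gives the bound directly.
    In Frechet spaces the bound comes from an open mapping theorem for closed
    convex relations: Baire's argument shows that the projection is dense near
    [0] ([absorbing_closure_nbhs]), and summing a geometric series removes the
    closure ([open_projection]). When [E] spans a finite-dimensional subspace,
    linear functionals on it extend continuously by composition with a suitable
    projection ([finite_dim_projection]), and an algebraic subgradient is enough.

    All the functionals come from one form of the Hahn-Banach theorem, stated for
    convex cones in [V * R] instead of sublinear functions
    ([hahn_banach_cone]). *)

Set Implicit Arguments.
Unset Strict Implicit.
Unset Printing Implicit Defensive.

Import Order.TTheory GRing.Theory Num.Theory.
Import numFieldNormedType.Exports.

Local Open Scope classical_set_scope.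
Local Open Scope ring_scope.

(** * Convex sets and conic hulls *)

Section ConvexSets.
Context {R : realType} {V : lmodType R}.
Implicit Types (A : set V) (p q : V).

Lemma convex_setP A : convex_set A <->
  forall p q (a b : R), A p -> A q -> 0 <= a -> 0 <= b -> a + b = 1 ->
    A (a *: p + b *: q).
Proof.
split=> [cA p q a b Ap Aq a0 b0 ab|cA p q t /set_mem Ap /set_mem Aq].
  have a1 : a <= 1 by rewrite -ab lerDl.
  have -> : b = 1 - a by rewrite -ab [a + b]addrC addrK.
  by have /set_mem := cA p q (Itv01 a0 a1) (mem_set Ap) (mem_set Aq).
by apply/mem_set/cA => //; [rewrite subr_ge0|rewrite addrC subrK].
Qed.

Lemma convex_star A t p : convex_set A -> A 0 -> 0 <= t <= 1 -> A p -> A (t *: p).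
Proof.
move=> /convex_setP cA A0 /andP[t0 t1] Ap.
rewrite -[_ *: _]addr0 -[X in _ + X](scaler0 V (1 - t)).
by apply: cA => //; rewrite ?subr_ge0 // addrC subrK.
Qed.

Definition conic_hull A : set V :=
  [set t *: p | t in [set t : R | 0 <= t] & p in A].

Lemma conic_hullZ A t p : 0 <= t -> conic_hull A p -> conic_hull A (t *: p).
Proof.
move=> t0 [s /= s0 [a Aa <-]]; exists (t * s); first exact: mulr_ge0.
by exists a => //; rewrite scalerA.
Qed.

Lemma sub_conic_hull A : A `<=` conic_hull A.
Proof. by move=> p Ap; exists 1 => //=; exists p; rewrite ?scale1r. Qed.

Lemma conic_hullD A p q :
  convex_set A -> conic_hull A p -> conic_hull A q -> conic_hull A (p + q).
Proof.
move=> /convex_setP cA [s /= s0 [a Aa <-]] [t /= t0 [b Ab <-]].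
have [st0|st_neq0] := eqVneq (s + t) 0.
  have /andP[/eqP-> /eqP->] : (s == 0) && (t == 0) by rewrite -paddr_eq0 ?st0.
  by exists 0 => //=; exists a; rewrite // !scale0r addr0.
have st_gt0 : 0 < s + t by rewrite lt_neqAle eq_sym st_neq0 addr_ge0.
exists (s + t) => /=; first exact: ltW.
exists ((s / (s + t)) *: a + (t / (s + t)) *: b).
  have st_ge0 := ltW st_gt0.
  by apply: cA => //; [exact: divr_ge0|exact: divr_ge0|rewrite -mulrDl divff].
by rewrite scalerDr !scalerA !(mulrCA (s + t)) divff // !mulr1.
Qed.

End ConvexSets.

(** * The Hahn-Banach theorem for cones *)

Section HahnBanach.
Context {R : realType} {V : lmodType R}.
Implicit Types Q : set (V * R^o).

(** A set of points required to lie above the graph of a linear function; the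
    last field is the only obstruction, found over [0]. Such cones replace the
    epigraphs of sublinear functions: they are easier to build than the
    functions, and are ordered by inclusion. *)
Record bounding_cone Q : Prop := BoundingCone {
  bc0 : Q 0;
  bcD : forall p q, Q p -> Q q -> Q (p + q);
  bcZ : forall (t : R) p, 0 <= t -> Q p -> Q (t *: p);
  bc_ge0 : forall r, Q (0, r) -> 0 <= r }.

Lemma maximal_bounding_cone Q : bounding_cone Q ->
  exists M, [/\ Q `<=` M, bounding_cone M &
    forall N, bounding_cone N -> M `<=` N -> N `<=` M].
Proof.
(* the empty set takes care of the union of the empty chain *)
move=> QP; pose P := [set A | A = set0 \/ (Q `<=` A /\ bounding_cone A)].
have [|M [[M0|[QM MP]] Mmax]] := @Zorn_bigcup _ P.
- move=> F FP Ftot.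
  have [[A [FA [QA AP]]]|nF] :=
    pselect (exists A, F A /\ (Q `<=` A /\ bounding_cone A)); last first.
    left; rewrite -subset0 => x [A FA Ax]; have [A0|PA] := FP _ FA.
      by rewrite A0 in Ax.
    by apply: nF; exists A.
  have FE B x : F B -> B x -> bounding_cone B.
    by move=> FB Bx; have [B0|[]//] := FP _ FB; rewrite B0 in Bx.
  right; split; first by move=> x Qx; exists A => //; exact: QA.
  split.
  + by exists A => //; exact: bc0.
  + move=> p q [B FB Bp] [B' FB' Bq].
    have [BB'|BB'] := Ftot _ _ FB FB'.
      by exists B' => //; exact: (bcD (FE _ _ FB' Bq) (BB' _ Bp) Bq).
    by exists B => //; exact: (bcD (FE _ _ FB Bp) Bp (BB' _ Bq)).
  + by move=> t p t0 [B FB Bp]; exists B => //; exact: (bcZ (FE _ _ FB Bp) t0 Bp).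
  + by move=> r [B FB Br]; have BP := FE _ _ FB Br; exact: (bc_ge0 BP Br).
- exfalso; apply: (Mmax Q); last by right; split.
  by rewrite M0; split=> // /(_ 0 (bc0 QP)).
- exists M; split=> // N NP MN; apply: contrapT => NM.
  apply: (Mmax N); first by split.
  by right; split => //; exact: subset_trans MN.
Qed.

(** The Hahn-Banach theorem. If [M] is a maximal cone, the sublinear function
    [p v = inf {r | M (v, r)}] is odd, since the point [(- v, - p v)] can be
    added to [M]; and a sublinear odd function is linear. *)
Lemma hahn_banach_cone Q : bounding_cone Q -> (forall v, exists r, Q (v, r)) ->
  exists l : {linear V -> R^o}, forall v r, Q (v, r) -> l v <= r.
Proof.
move=> QP Qtot; have [M [QM MP Mmax]] := maximal_bounding_cone QP.
have Mtot v : exists r, M (v, r).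
  by have [r Qr] := Qtot v; exists r; exact: QM.
pose p v : R := inf [set r | M (v, r)].
have p_le v r : M (v, r) -> p v <= r.
  move=> Mr; apply: ge_inf => //; have [s Ms] := Mtot (- v).
  exists (- s) => t /= Mt; rewrite lerNl -subr_ge0 opprK addrC.
  by apply: (bc_ge0 MP); rewrite -(subrr v); exact: (bcD MP Mt Ms).
have p_ge v c : (forall r, M (v, r) -> c <= r) -> c <= p v.
  by move=> cM; apply: lb_le_inf; [exact: Mtot|move=> r; exact: cM].
have pZ_le t v : 0 < t -> p (t *: v) <= t * p v.
  move=> t0; rewrite -ler_pdivrMl //; apply: p_ge => r Mr.
  rewrite ler_pdivrMl //; apply: p_le.
  by have := bcZ MP (ltW t0) Mr.
have pD u v : p (u + v) <= p u + p v.
  rewrite -lerBlDr; apply: (p_ge) => r Mr; rewrite lerBlDr -lerBlDl.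
  apply: p_ge => s Ms; rewrite lerBlDl; apply: p_le.
  exact: (bcD MP Mr Ms).
have p0 : p 0 = 0.
  apply/eqP; rewrite eq_le p_le ?p_ge //; last exact: (bc0 MP).
  by move=> r /(bc_ge0 MP).
have Mopp v : M (- v, - p v).
  pose N : set (V * R^o) :=
    [set q + t *: (- v, - p v) | q in M & t in [set t : R | 0 <= t]].
  have MN : M `<=` N.
    by move=> q Mq; exists q => //; exists 0 => /=; rewrite // scale0r addr0.
  apply: (Mmax N) => //; last first.
    by exists 0; [exact: (bc0 MP)|exists 1; rewrite //= scale1r add0r].
  split.
  - exact: (MN _ (bc0 MP)).
  - move=> _ _ [q1 M1 [t1 /= t10 <-]] [q2 M2 [t2 /= t20 <-]].
    exists (q1 + q2); first exact: (bcD MP).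
    by exists (t1 + t2); rewrite /= ?addr_ge0 // scalerDl addrACA.
  - move=> s _ s0 [q Mq [t /= t0 <-]]; exists (s *: q); first exact: (bcZ MP).
    by exists (s * t); rewrite /= ?mulr_ge0 // scalerDr scalerA.
  - move=> r [[w s] Mq [t /= t0]] [] /eqP.
    (* a point of the enlarged cone over [0] comes from [(t *: v, s)] in [M] *)
    rewrite scalerN subr_eq0 => /eqP wE <-.
    rewrite [_ *: _]mulrN subr_ge0.
    have [t_eq0|tn0] := eqVneq t 0.
      rewrite t_eq0 mul0r; apply: (bc_ge0 MP).
      by rewrite wE t_eq0 scale0r in Mq.
    have tp : 0 < t by rewrite lt_neqAle eq_sym tn0.
    rewrite -ler_pdivlMl //; apply: p_le.
    have ti0 : 0 <= t^-1 by rewrite invr_ge0 ltW.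
    by rewrite -[v]scale1r -(mulVf tn0) -scalerA -wE; exact: (bcZ MP ti0 Mq).
have pN v : p (- v) = - p v.
  apply/eqP; rewrite eq_le (p_le _ _ (Mopp v)) /= -subr_ge0 opprK.
  by have := pD (- v) v; rewrite addNr p0.
have pDE u v : p (u + v) = p u + p v.
  apply/eqP; rewrite eq_le pD /= -lerN2 -pN opprD.
  by rewrite (le_trans (pD _ _)) // !pN opprD.
have pZ t v : p (t *: v) = t * p v.
  have pZp s w : 0 < s -> p (s *: w) = s * p w.
    move=> s0; apply/eqP; rewrite eq_le pZ_le //=.
    rewrite -lerN2 -mulrN -!pN -scalerN; exact: pZ_le.
  have [t0|t0|->] := ltgtP t 0; [|exact: pZp|by rewrite scale0r p0 mul0r].
  by rewrite -[in LHS](opprK t) scaleNr pN pZp ?oppr_gt0 // mulNr opprK.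
have p_linear : linear (p : V -> R^o) by move=> t u v; rewrite pDE pZ.
pose l : {linear V -> R^o} :=
  HB.pack (p : V -> R^o) (GRing.isLinear.Build R V R^o *:%R p p_linear).
by exists l => v r Qr; apply: p_le; exact: QM.
Qed.

End HahnBanach.

(** * Continuous minorants of convex sets *)

Section TopologicalVectorSpace.
Context {R : realType} {V : tvsType R}.
Implicit Types (U : set V) (v x : V).

Lemma scale_shift_continuous (a : R) x : continuous (fun v : V => a *: v + x).
Proof.
move=> v; apply: (@continuous_comp V (V * V)%type V
  (fun v => (a *: v, x)) (fun p => p.1 + p.2)); last exact: add_continuous.
apply: cvg_pair; last exact: cvg_cst.
apply: (@continuous_comp V (R^o * V)%type V
  (fun v => (a, v)) (fun p => p.1 *: p.2)); last exact: scale_continuous.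
by apply: (@cvg_pair _ _ _ _ (nbhs (a : R^o))); [exact: cvg_cst|exact: cvg_id].
Qed.

Lemma nbhs_scale_shift (a : R) x v U :
  nbhs (a *: v + x) U -> nbhs v [set w | U (a *: w + x)].
Proof. exact: scale_shift_continuous. Qed.

Lemma nbhs_segment x v U : nbhs x U ->
  exists2 e : R, 0 < e & forall t : R, `|t| < e -> U (x + t *: v).
Proof.
move=> xU; have cont : continuous (fun t : R^o => x + t *: v).
  move=> t; apply: (@continuous_comp R^o (V * V)%type V
    (fun t => (x, t *: v)) (fun p => p.1 + p.2)); last exact: add_continuous.
  apply: cvg_pair; first exact: cvg_cst.
  apply: (@continuous_comp R^o (R^o * V)%type V
    (fun t => (t, v)) (fun p => p.1 *: p.2)); last exact: scale_continuous.
  by apply: (@cvg_pair _ _ _ _ (nbhs (t : R^o))); [exact: cvg_id|exact: cvg_cst].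
have /nbhs_ballP[e e0 eU] : nbhs (0 : R^o) [set t : R^o | U (x + t *: v)].
  by apply: cont; rewrite scale0r addr0.
exists e => // t te; apply: eU.
by rewrite -ball_normE /= sub0r normrN.
Qed.

Lemma convex_nbhs U : nbhs 0 U ->
  exists2 W, nbhs 0 W /\ convex_set W & W `<=` U.
Proof.
move=> U0; have [B Bconvex [Bopen Bbasis]] := @locally_convex R V.
have [W [BW W0] WU] := Bbasis 0 U U0.
exists W => //; split; last exact/Bconvex/mem_set.
by apply: open_nbhs_nbhs; split => //; exact: Bopen.
Qed.

Lemma linear_bounded_above_continuous (l : {linear V -> R^o}) U (M : R) :
  nbhs 0 U -> (forall v, U v -> l v <= M) -> continuous l.
Proof.
move=> U0 lM x; apply/(@cvgrPdist_lt _ R^o) => e e0.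
pose c : R := (`|M| + 1) / e.
have M1 : 0 < `|M| + 1 by rewrite ltr_wpDl.
have c0 : 0 < c by rewrite divr_gt0.
have lc v : U v -> l v < c * e.
  move=> /lM lv; rewrite /c divfK ?gt_eqF // (le_lt_trans lv) //.
  by rewrite (le_lt_trans (ler_norm M)) // ltrDl.
have near1 a : nbhs x [set y | U (a *: y + - (a *: x))].
  by apply: nbhs_scale_shift; rewrite subrr.
near=> y.
have /lc : U (c *: y + - (c *: x)) by near: y; exact: near1.
have /lc : U (- c *: y + - (- c *: x)) by near: y; exact: near1.
have lE a : l (a *: y + - (a *: x)) = a * (l y - l x).
  by rewrite -scalerBr linearZ linearB.
rewrite !lE mulNr -mulrN !(ltr_pM2l c0) opprB => h1 h2.
by rewrite ltr_norml h1 ltrNl opprB h2.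
Unshelve. all: by end_near. Qed.

(** The cone spanned by [H] and [U x {M}] projects onto [V] because [U] is a
    neighbourhood of [0], and the last hypothesis says that it contains no point
    of the negative vertical axis: [hahn_banach_cone] applies to it. The part
    [U x {M}] makes the functional bounded above by [M] on [U], hence
    continuous. *)
Lemma affine_sandwich (H : set (V * R^o)) U (M : R) :
  convex_set H -> H !=set0 -> convex_set U -> nbhs 0 U ->
  (forall w r u (a b : R), H (w, r) -> U u -> 0 <= a -> 0 <= b ->
     a *: w + b *: u = 0 -> 0 <= a * r + b * M) ->
  exists l : continuous_linear V R^o, forall w r, H (w, r) -> l w <= r.
Proof.
move=> cH [[w0 r0] H0] cU U0 compat.
pose UM : set (V * R^o) := [set q | U q.1 /\ q.2 = M].
have cUM : convex_set UM.
  apply/convex_setP => -[u r] [v s] a b [/= Uu ->] [/= Uv ->] a0 b0 ab.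
  split; first by move/convex_setP: cU; apply.
  by rewrite [LHS]/= -[_ *: _]/(a * M) -[X in _ + X]/(b * M) -mulrDl ab mul1r.
have UM0 : UM (0, M) by split => //=; exact: nbhs_singleton.
pose Q : set (V * R^o) :=
  [set p + q | p in conic_hull H & q in conic_hull UM].
have HQ p : conic_hull H p -> Q p.
  move=> Hp; exists p => //; exists 0; last exact: addr0.
  by exists 0 => //=; exists (0, M); rewrite ?scale0r.
have UQ q : conic_hull UM q -> Q q.
  move=> Uq; exists 0; last by exists q => //; exact: add0r.
  by exists 0 => //=; exists (w0, r0); rewrite ?scale0r.
have QP : bounding_cone Q.
  split.
  - by apply: HQ; exists 0 => //=; exists (w0, r0); rewrite ?scale0r.
  - move=> _ _ [p1 H1 [q1 U1 <-]] [p2 H2 [q2 U2 <-]].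
    by exists (p1 + p2); [exact: conic_hullD|exists (q1 + q2);
      [exact: conic_hullD|exact: addrACA]].
  - move=> t _ t0 [p Hp [q Uq <-]].
    by exists (t *: p); [exact: conic_hullZ|exists (t *: q);
      [exact: conic_hullZ|rewrite scalerDr]].
  - move=> r [_ [a /= a0 [[w s] Hw <-]]] [_ [b /= b0 [[u t] [/= Uu ->] <-]]].
    move=> [wu <-]; exact: compat Hw Uu a0 b0 wu.
have Qtot v : exists r, Q (v, r).
  have [e e0 eU] := nbhs_segment (v - w0) U0.
  have e20 : 0 < e / 2 by rewrite divr_gt0.
  exists (r0 + (e / 2)^-1 * M), (w0, r0); first exact: sub_conic_hull.
  exists ((e / 2)^-1 *: ((e / 2) *: (v - w0), M : R^o)).
    exists (e / 2)^-1; first by rewrite /= invr_ge0 ltW.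
    exists ((e / 2) *: (v - w0), M : R^o) => //; split => //=.
    rewrite -[_ *: _]add0r; apply: eU.
    by rewrite gtr0_norm // ltr_pdivrMr // ltr_pMr // ltr1n.
  congr pair => /=; rewrite scalerA mulVf ?gt_eqF // scale1r.
  by rewrite addrC subrK.
have [l lQ] := hahn_banach_cone QP Qtot.
have lU u : U u -> l u <= M.
  by move=> Uu; apply: lQ; apply: UQ; exact: sub_conic_hull.
exists (ContinuousLinear (linear_bounded_above_continuous U0 lU)) => w r Hw.
by apply: lQ; apply: HQ; exact: sub_conic_hull.
Qed.

(** [H] is the epigraph of a convex function that is nonnegative at [0], and the
    conclusion is that it has a continuous subgradient at [0]. If [a w + b u = 0]
    with [w] in the domain, then [u] is in [W], where the function is at most
    [M]; by convexity the average of [r] and [M] is the ordinate of a point of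
    [H] above [0]. Thus [H] and [U x {M}] can be sandwiched. *)
Lemma subgradient_of_bounded (H : set (V * R^o)) (W U : set V) (M : R) :
  convex_set H -> (forall r, H (0, r) -> 0 <= r) ->
  is_subspace W -> (forall w r, H (w, r) -> W w) ->
  nbhs 0 U -> (forall u, U u -> W u -> H (u, M)) ->
  exists l : continuous_linear V R^o, forall w r, H (w, r) -> l w <= r.
Proof.
move=> cH H_ge0 [W0 Wlin] HW U0 UH.
have HM : H (0, M) by apply: UH => //; exact: nbhs_singleton.
have M0 : 0 <= M := H_ge0 _ HM.
have [U' [U'0 cU'] U'U] := convex_nbhs U0.
apply: (affine_sandwich cH _ cU' U'0 (M := M)); first by exists (0, M).
move=> w r u a b Hw Uu a0 b0 wu.
have [b_eq0|b_neq0] := eqVneq b 0.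
  rewrite b_eq0 mul0r addr0; have [->|a_neq0] := eqVneq a 0.
    by rewrite mul0r.
  rewrite mulr_ge0 //; apply: H_ge0.
  move/eqP: wu; rewrite b_eq0 scale0r addr0 scaler_eq0 (negbTE a_neq0) /=.
  by move=> /eqP <-.
have b_gt0 : 0 < b by rewrite lt_neqAle eq_sym b_neq0.
have ab : 0 < a + b by rewrite ltr_wpDl.
have uE : u = (- (a / b)) *: w + 0.
  apply: (scalerI b_neq0); rewrite addr0 scalerA mulrN mulrCA divff // mulr1.
  by rewrite scaleNr; apply/eqP; rewrite -subr_eq0 opprK addrC wu.
have Hu : H (u, M).
  by apply: UH; [exact: U'U|rewrite uE; apply: Wlin => //; exact: HW Hw].
have : 0 <= (a / (a + b)) * r + (b / (a + b)) * M.
  apply: H_ge0.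
  have -> : (0 : V) = (a / (a + b)) *: w + (b / (a + b)) *: u.
    by rewrite ![_ / _]mulrC -!scalerA -scalerDr wu scaler0.
  move/convex_setP: cH => cH; have ab0 := ltW ab.
  apply: (cH (w, r : R^o) (u, M : R^o)) => //; rewrite ?divr_ge0 //.
  by rewrite -mulrDl divff ?gt_eqF.
by rewrite ![_ / _]mulrC -!mulrA -mulrDr pmulr_rge0 ?invr_gt0.
Qed.

End TopologicalVectorSpace.

Lemma functionalZ (R : realType) (V : lmodType R) (l : {linear V -> R^o})
  (t : R) v : l (t *: v) = t * l v.
Proof. exact: linearZ. Qed.

(** * Interior of a convex cone and separation *)

Section ConeInterior.
Context {R : realType} {Y : tvsType R} (K : set Y).
Hypotheses (K_convex : convex_set K) (K_cone : is_cone K).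

Lemma coneD x y : K x -> K y -> K (x + y).
Proof.
move=> Kx Ky; have -> : x + y = 2 *: (2^-1 *: x + 2^-1 *: y).
  by rewrite -scalerDr scalerA mulfV ?scale1r.
apply: K_cone => //; move/convex_setP: K_convex; apply=> //.
by rewrite [RHS]splitr div1r.
Qed.

Lemma interior_coneD x y : K° x -> K y -> K° (x + y).
Proof.
rewrite /interior => Kx Ky.
have : nbhs (1 *: (x + y) + - y) K by rewrite scale1r addrK.
move=> /nbhs_scale_shift; apply: filterS => z /=; rewrite scale1r => Kz.
by rewrite -[z](subrK y); exact: coneD.
Qed.

Lemma interior_coneZ (t : R) x : 0 < t -> K° x -> K° (t *: x).
Proof.
rewrite /interior => t0 Kx; have := nbhsZ (lt0r_neq0 t0) Kx.
by apply: filterS => _ [z Kz <-]; apply: K_cone => //; exact: ltW.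
Qed.

Lemma interior_coneD_ge0 x y (s t : R) :
  0 <= s -> 0 < t -> K° x -> K° y -> K° (s *: x + t *: y).
Proof.
move=> s0 t0 Kx Ky; rewrite addrC; apply: interior_coneD.
  exact: interior_coneZ.
by apply: K_cone => //; exact: interior_subset.
Qed.

Lemma interior_cone_segment x v : K° x ->
  exists2 e : R, 0 < e & K° (x + e *: v).
Proof.
move=> Kx; have [e e0 eK] := nbhs_segment v (nbhs_interior Kx).
exists (e / 2); first by rewrite divr_gt0.
by apply: eK; rewrite gtr0_norm ?divr_gt0 // ltr_pdivrMr // ltr_pMr // ltr1n.
Qed.

(** Strict separation of [D] from [- K°]. Sandwiching the functional between
    the value [- t] at [- (d + t e)] and the value [1] on [e - K°] forces it to
    be at least [1] at [e], hence to be nonzero. *)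
Lemma weak_separation (D : set Y) :
  K° !=set0 -> convex_set D -> K `<=` D -> (forall d, D d -> ~ K° (- d)) ->
  exists y : continuous_linear Y R^o,
    (forall d, D d -> 0 <= y d) /\ (forall k, K° k -> 0 < y k).
Proof.
move=> [e Ke] cD KD Dneg.
have D0 : D 0.
  by apply/KD; rewrite -(scale0r e); apply: K_cone => //; exact: interior_subset.
pose H : set (Y * R^o) :=
  [set p | exists d t, [/\ D d, 0 <= t & p = (- (d + t *: e), - t)]].
pose U : set Y := [set v | K° (e - v)].
have cH : convex_set H.
  apply/convex_setP => _ _ a b [d [t [Dd t0 ->]]] [d' [t' [Dd' t'0 ->]]] a0 b0 ab.
  exists (a *: d + b *: d'), (a * t + b * t'); split.
  - by move/convex_setP: cD; apply.
  - by rewrite addr_ge0 // mulr_ge0.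
  - congr pair => /=; last by rewrite opprD -!mulrN.
    by rewrite !scalerN -opprD !scalerDr scalerDl !scalerA addrACA.
have cU : convex_set U.
  apply/convex_setP => v w a b; rewrite /U /= => Uv Uw a0 b0 ab.
  have -> : e - (a *: v + b *: w) = a *: (e - v) + b *: (e - w).
    by rewrite !scalerBr addrACA -scalerDl ab scale1r opprD.
  have [b_eq0|b_neq0] := eqVneq b 0.
    have a1 : a = 1 by rewrite -ab b_eq0 addr0.
    by rewrite b_eq0 a1 scale1r scale0r addr0.
  by apply: interior_coneD_ge0 => //; rewrite lt_neqAle eq_sym b_neq0.
have U0 : nbhs 0 U.
  have : nbhs (-1 *: 0 + e) K° by rewrite scaler0 add0r; exact: nbhs_interior.
  move=> /nbhs_scale_shift; apply: filterS => v /=.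
  by rewrite /U /= scaleN1r addrC.
have [||y yH] := affine_sandwich cH _ cU U0 (M := 1).
- by exists (- (0 + 0 *: e), - (0 : R^o)), 0, 0.
- move=> _ _ u a b [d [t [Dd t0 [-> ->]]]] Uu a0 b0 ab.
  rewrite mulrN mulr1 addrC subr_ge0 leNgt; apply/negP => bat.
  have a_gt0 : 0 < a.
    rewrite lt_neqAle a0 andbT; apply: contraTneq bat => <-.
    by rewrite mul0r -leNgt.
  apply: (Dneg _ Dd).
  have -> : - d = (b / a) *: (e - u) + (t - b / a) *: e.
    apply: (scalerI (lt0r_neq0 a_gt0)).
    rewrite scalerDr !scalerA mulrBr !(mulrCA a) divff ?gt_eqF // !mulr1.
    have /addr0_eq := ab; rewrite scalerN opprK => /esym buE.
    rewrite scalerN scalerBr buE scalerBl scalerDr scalerA.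
    by rewrite addrC addrA subrK opprD addrCA subrr addr0.
  apply: interior_coneD_ge0 => //; first by rewrite divr_ge0.
  by rewrite subr_gt0 ltr_pdivrMr // mulrC.
have y_ge0 d : D d -> 0 <= y d.
  move=> Dd; have := yH (- (d + 0 *: e)) (- 0 : R^o).
  rewrite scale0r addr0 oppr0 linearN lerNl oppr0; apply.
  by exists d, 0; rewrite scale0r addr0 oppr0.
have ye_ge1 : 1 <= y e.
  have := yH (- (0 + 1 *: e)) (- 1 : R^o).
  rewrite scale1r add0r linearN lerN2; apply.
  by exists 0, 1; rewrite scale1r add0r.
exists y; split => // k Kk; have [t t0 Kkt] := interior_cone_segment (- e) Kk.
have : 0 <= y (k + t *: - e) by apply/y_ge0/KD; exact: interior_subset.
rewrite linearD functionalZ linearN mulrN subr_ge0; apply: lt_le_trans.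
by rewrite mulr_gt0 // (lt_le_trans ltr01).
Qed.

End ConeInterior.

(** * Finite-dimensional subspaces *)

Section FiniteDimension.
Context {R : realType} {V : tvsType R}.

(** The value at [- t v] is forced to be at most [- t], while the values on a
    convex neighbourhood of [0] that misses [v] are at most [1]. *)
Lemma separating_functional (v : V) : hausdorff_space V -> v <> 0 ->
  exists l : continuous_linear V R^o, 1 <= l v.
Proof.
move=> hV v0; have [U U0 Uv] : exists2 U, nbhs (0 : V) U & ~ U v.
  apply: contrapT => nU; apply: v0; apply: hV => A B vA B0.
  exists v; split; first exact: nbhs_singleton.
  by apply: contrapT => nB; apply: nU; exists B.
have [W [W0 cW] WU] := convex_nbhs U0.
pose H : set (V * R^o) :=
  [set p | exists2 t, 0 <= t & p = (- (t *: v), - t : R^o)].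
have cH : convex_set H.
  apply/convex_setP => _ _ a b [s s0 ->] [t t0 ->] a0 b0 ab.
  exists (a * s + b * t); first by rewrite addr_ge0 // mulr_ge0.
  congr pair => /=; first by rewrite !scalerN -opprD scalerDl !scalerA.
  by rewrite opprD -!mulrN.
have [||l lH] := affine_sandwich cH _ cW W0 (M := 1).
- by exists (- (0 *: v), - (0 : R^o)), 0.
- move=> _ _ u a b [t t0 [-> ->]] Wu a0 b0 ab.
  rewrite mulrN mulr1 addrC subr_ge0 leNgt; apply/negP => bat.
  have at0 : 0 < a * t by exact: le_lt_trans bat.
  have vE : v = (b / (a * t)) *: u.
    apply: (scalerI (lt0r_neq0 at0)).
    rewrite scalerA mulrCA divff ?gt_eqF // mulr1.
    by have /addr0_eq := ab; rewrite scalerN opprK scalerA.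
  apply/Uv/WU; rewrite vE; apply: convex_star => //.
    exact: nbhs_singleton.
  by rewrite divr_ge0 ?(ltW at0) //= ler_pdivrMr // mul1r ltW.
exists l; have := lH (- (1 *: v)) (- 1 : R^o).
by rewrite scale1r linearN lerN2; apply; exists 1; rewrite ?scale1r.
Qed.

Lemma lin_subspace (U : set V) : is_subspace (lin U).
Proof.
split=> [W [[W0 _] _]//|t u v Uu Uv W WP].
by have [[_ Wlin] _] := WP; apply: Wlin; [exact: Uu|exact: Uv].
Qed.

(** Every linear functional on a finite-dimensional subspace extends
    continuously: it is enough to compose it with [P]. One more generator [v]
    is absorbed by adding to [P] a multiple of [v - P v], with a coefficient
    that vanishes on the range of [P] and is [1] at [v]. *)
Lemma finite_dim_projection (s : seq V) : hausdorff_space V ->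
  exists P : {linear V -> V},
    [/\ forall v, lin [set` s] (P v), forall v, lin [set` s] v -> P v = v &
      forall l : {linear V -> R^o}, continuous (l \o P)].
Proof.
move=> hV; elim: s => [|v s [P [Ps sP cP]]].
  have lin0 : lin [set` [::]] `<=` [set (0 : V)].
    apply: smallest_sub => [|x //]; split=> // t _ _ -> ->.
    by rewrite scaler0 addr0.
  exists (\0 : {linear V -> V}); split.
  - by move=> v; have [] := lin_subspace [set` [::]].
  - by move=> v /lin0 ->.
  - move=> l; have -> : (l \o \0 : V -> R^o) = (fun=> 0).
      by apply/funext => v /=; rewrite linear0.
    by move=> x; exact: cvg_cst.
have sub_lin : lin [set` s] `<=` lin [set` v :: s].
  apply: smallest_sub; first exact: lin_subspace.
  by move=> x /= xs; apply: sub_gen_smallest; rewrite /= in_cons xs orbT.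
pose u := v - P v.
have [g gu] : exists g : continuous_linear V R^o, ((g u)^-1 * g u) *: u = u.
  have [u0|/eqP u0] := eqVneq u 0; first by exists clin0; rewrite u0 scaler0.
  have [g g1] := separating_functional hV u0.
  by exists g; rewrite mulVf ?scale1r // gt_eqF // (lt_le_trans ltr01).
pose f z := P z + ((g u)^-1 * g (z - P z)) *: u.
have f_linear : linear f.
  move=> t x y; rewrite /f.
  have -> : g (t *: x + y - P (t *: x + y)) = t * g (x - P x) + g (y - P y).
    rewrite -functionalZ -linearD; congr (g _).
    by rewrite linearP opprD addrACA scalerBr.
  by rewrite linearP mulrDr scalerDl [in RHS]scalerDr scalerA mulrCA addrACA.
pose P' : {linear V -> V} :=
  HB.pack f (GRing.isLinear.Build R V V *:%R f f_linear).
have [lin0 linP] := lin_subspace [set` v :: s].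
have P's z : lin [set` v :: s] (P' z).
  rewrite /P' /= /f addrC; apply: (linP) => //; last exact: sub_lin.
  rewrite /u -scaleN1r addrC; apply: linP; first exact: sub_lin.
  by apply: sub_gen_smallest; rewrite /= mem_head.
exists P'; split => //.
- apply: smallest_sub.
    split; first exact: linear0.
    by move=> t x y Px Py; have := linearP P' t x y; rewrite Px Py.
  move=> x /=; rewrite in_cons => /orP[/eqP ->|xs]; rewrite /P' /= /f.
    by rewrite gu addrC subrK.
  have Px : P x = x by apply: sP; exact: sub_gen_smallest.
  by rewrite Px subrr linear0 mulr0 scale0r addr0.
- move=> l; have -> : (l \o P' : V -> R^o) =
      (fun z => l (P z) + (g u)^-1 * l u * (g z - g (P z))).
    apply/funext => z.
    have fE : l (f z) = (g u)^-1 * g (z - P z) * l u + l (P z).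
      exact: (eq_trans (congr1 l (addrC _ _)) (linearP l _ _ _)).
    by rewrite [LHS]fE (linearB g z) [LHS]addrC mulrAC.
  move=> z; apply: cvgD; first exact: cP.
  apply: cvgM; first exact: cvg_cst.
  by apply: cvgB; [exact: clin_continuous|exact: cP].
Qed.

End FiniteDimension.

(** * Baire's argument in Frechet spaces *)

Local Notation half k := ((2^-1 : _) ^+ k).

Lemma half_lt (R : realType) (e : R) : 0 < e ->
  exists N, forall k, (N <= k)%N -> half k < e.
Proof.
move=> e0; have h1 : `|2^-1 : R| < 1.
  by rewrite gtr0_norm ?invr_gt0 // invf_lt1 // ltr1n.
have /(@cvgrPdist_lt _ R^o) /(_ _ e0) [N _ NP] := cvg_expr h1.
exists N => k Nk; have := NP k Nk.
by rewrite /= sub0r normrN ger0_norm // exprn_ge0 // invr_ge0.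
Qed.

Lemma halfS (R : realType) k : half k = 2 * half k.+1 :> R.
Proof. by rewrite exprS mulrA mulfV // mul1r. Qed.

Lemma half_gt0 (R : realType) k : 0 < half k :> R.
Proof. by rewrite exprn_gt0 // invr_gt0. Qed.

Section FNorm.
Context {R : realType} {V : tvsType R}.

(** The distance to [0] for a complete translation-invariant metric. It is not
    homogeneous, and its balls need not be convex. *)
Record fnorm (n : V -> R) : Prop := Fnorm {
  fnorm0 : n 0 = 0;
  fnormN : forall x, n (- x) = n x;
  fnormD : forall x y, n (x + y) <= n x + n y;
  fnorm_nbhs : forall x (U : set V),
    nbhs x U <-> exists2 e : R, 0 < e & forall v, n (v - x) < e -> U v;
  fnorm_cvg : forall u : nat -> V,
    (forall k, n (u k.+1 - u k) <= half k) -> exists l : V, u @ \oo --> l }.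

Lemma frechet_fnorm : frechet_space V -> exists n, fnorm n.
Proof.
move=> [d [[d_ge0 dC d_tri d_inv] [d_nbhs d_cvg]]].
have dE x y : d x y = d (x - y) 0 by rewrite -(d_inv x y (- y)) subrr.
have nN x : d (- x) 0 = d x 0 by rewrite -(d_inv _ _ x) addNr add0r dC.
have n0 : d 0 0 = 0 by have [_ [_]] := d_ge0 0 0; exact.
have nD x y : d (x + y) 0 <= d x 0 + d y 0.
  apply: le_trans (d_tri _ y _) _; rewrite lerD2r.
  by rewrite -(d_inv x 0 y) add0r.
exists (d ^~ 0); split => // [x U|u du].
  rewrite d_nbhs; split=> -[e e0 eU]; exists e => // v.
    by rewrite -dE dC; exact: eU.
  by rewrite /= dC dE; exact: eU.
have telescope N j : d (u (N + j)%N) (u N) <= 2 * half N - 2 * half (N + j)%N.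
  elim: j => [|j IHj]; first by rewrite addn0 dE !subrr n0.
  rewrite addnS (le_trans (d_tri _ (u (N + j)%N) _)) //.
  have := du (N + j)%N; rewrite -dE => duj.
  rewrite (le_trans (lerD duj IHj)) // -halfS.
  by rewrite mulr2n mulrDl mul1r; lra.
have dist N m : (N <= m)%N -> d (u m) (u N) <= 2 * half N.
  move=> Nm; rewrite -(subnKC Nm) (le_trans (telescope _ _)) //.
  by rewrite lerBlDr lerDl mulr_ge0 // ltW // half_gt0.
apply: d_cvg => e e0; have [N NP] := half_lt (divr_gt0 e0 (ltr0Sn _ 3)).
exists N => m k Nm Nk; apply: le_lt_trans (d_tri _ (u N) _) _.
rewrite [d (u N) _]dC (le_lt_trans (lerD (dist _ _ Nm) (dist _ _ Nk))) //.
by have := NP N (leqnn N); rewrite ltr_pdivlMr //; lra.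
Qed.

Variable n : V -> R.
Hypothesis nP : fnorm n.

Lemma fnorm_ball x (e : R) : 0 < e -> nbhs x [set v | n (v - x) < e].
Proof. by move=> e0; apply/(fnorm_nbhs nP); exists e. Qed.

Lemma fnormB x y : n (x - y) = n (y - x).
Proof. by rewrite -(fnormN nP) opprB. Qed.

Lemma fnorm_cvg_near (u : nat -> V) l (e : R) : 0 < e -> u @ \oo --> l ->
  exists N, forall k, (N <= k)%N -> n (u k - l) < e.
Proof. by move=> /(fnorm_ball l) le ul; have [N _] := ul _ le; exists N. Qed.

Lemma closure_scale_shift (A B : set V) (a : R) x v :
  (forall y, A y -> B (a *: y + x)) -> closure A v -> closure B (a *: v + x).
Proof.
move=> AB Av U /nbhs_scale_shift /Av [y [Ay Uy]].
by exists (a *: y + x); split => //; exact: AB.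
Qed.

(** Baire's argument in the complete metric space [W]: if the closures of the
    sets [m A] had empty interior in [W], nested balls avoiding them one after
    the other would shrink to a point of [W] that no multiple of [A] contains. *)
Lemma absorbing_closure_interior (W A : set V) :
  closed W -> is_subspace W -> convex_set A -> A 0 ->
  (forall w, W w -> exists2 t : R, 0 < t & A (t *: w)) ->
  exists m w0 (e : R), [/\ W w0, 0 < e &
    forall w, W w -> n (w - w0) < e -> closure A (m.+1%:R^-1 *: w)].
Proof.
move=> cW [W0 Wlin] cA A0 Aabs; apply: contrapT => nowhere.
(* the state [(m, (w, e))] is a step number, a centre and a radius; the next ball
   is disjoint from [m.+1 A] *)
have step (q : nat * (V * R)) : exists p : V * R, W q.2.1 -> 0 < q.2.2 ->
    [/\ W p.1, 0 < p.2, p.2 <= q.2.2 / 2, n (p.1 - q.2.1) <= q.2.2 / 2 &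
      forall y, n (y - p.1) <= p.2 -> ~ A (q.1.+1%:R^-1 *: y)].
  case: q => m [w0 e] /=; have [Ww0|nW] := pselect (W w0); last by exists (0, 0).
  have [e0|e_le0] := ltP 0 e; last by exists (0, 0).
  have e20 : 0 < e / 2 by rewrite divr_gt0.
  have [w [Ww we Aw]] : exists w, [/\ W w, n (w - w0) < e / 2 &
      ~ closure A (m.+1%:R^-1 *: w)].
    apply: contrapT => nw; apply: nowhere; exists m, w0, (e / 2).
    split=> // w Ww we; apply: contrapT => Aw; apply: nw.
    by exists w.
  have [U Uw UA] : exists2 U, nbhs (m.+1%:R^-1 *: w) U & ~ (A `&` U !=set0).
    apply: contrapT => nU; apply: Aw => U Uw.
    by apply: contrapT => AU; apply: nU; exists U.
  rewrite -[m.+1%:R^-1 *: w]addr0 in Uw.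
  have /(fnorm_nbhs nP)[d d0 dU] := nbhs_scale_shift Uw.
  exists (w, Num.min (d / 2) (e / 2)) => _ _; split => //=.
  - by rewrite lt_min !divr_gt0.
  - by rewrite ge_min lexx orbT.
  - exact: ltW.
  - move=> y; rewrite le_min => /andP[yd _] Ay; apply: UA.
    exists (m.+1%:R^-1 *: y); split=> //.
    have := dU y; rewrite /= addr0; apply; apply: le_lt_trans yd _.
    by rewrite ltr_pdivrMr // ltr_pMr // ltr1n.
have [f fP] := choice step.
pose p := fix p k := if k is k'.+1 then f (k', p k') else (0 : V, 1 : R).
have pP k : W (p k).1 /\ 0 < (p k).2.
  by elim: k => [|k [Wk ek]] //=; have [] := fP (k, p k) Wk ek.
have pS k := fP (k, p k) (pP k).1 (pP k).2.
have p_half k : (p k).2 <= half k.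
  elim: k => [|k IHk] /=; first by rewrite expr0.
  have [_ _ eS _ _] := pS k; apply: le_trans eS _.
  by rewrite exprSr ler_pM2r ?invr_gt0.
have [|l pl] := fnorm_cvg nP (u := fun k => (p k).1).
  move=> k; have [_ _ _ wS _] := pS k; apply: le_trans wS _.
  rewrite ler_pdivrMr //; apply: le_trans (p_half k) _.
  by rewrite ler_peMr // ?ler1n // ltW // half_gt0.
have Wl : W l.
  have near_W : \forall k \near \oo, W (p k).1.
    by exists 0%N => // k _; have [] := pP k.
  exact: (@closed_cvg _ _ _ _ (fun k => (p k).1) W cW near_W _ pl).
have nested k j : n ((p (k + j)%N).1 - (p k).1) <= (p k).2 - (p (k + j)%N).2.
  elim: j => [|j IHj]; first by rewrite addn0 !subrr (fnorm0 nP).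
  rewrite addnS; have [_ _ eS wS _] := pS (k + j)%N.
  have -> : (p (k + j).+1).1 - (p k).1 =
      ((p (k + j).+1).1 - (p (k + j)%N).1) + ((p (k + j)%N).1 - (p k).1).
    by rewrite addrA subrK.
  apply: le_trans (fnormD nP _ _) _; apply: le_trans (lerD wS IHj) _.
  by move: eS; set a := (p (k + j).+1).2 => eS; lra.
have lp k : n (l - (p k).1) <= (p k).2.
  rewrite leNgt; apply/negP; rewrite -subr_gt0 => gap.
  have [N NP] := fnorm_cvg_near gap pl.
  have := NP (k + N)%N (leq_addl _ _); have := nested k N.
  have [_ eN] := pP (k + N)%N.
  have := fnormD nP (l - (p (k + N)%N).1) ((p (k + N)%N).1 - (p k).1).
  rewrite addrA subrK.
  rewrite [n (l - (p (k + N)%N).1)]fnormB.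
  by move=> h1 h2 h3; lra.
have [t t0 At] := Aabs _ Wl.
have [m _ mt] : exists2 m, True & m.+1%:R^-1 <= t.
  exists (Num.truncn t^-1) => //; rewrite invf_ple ?posrE //.
  by rewrite ltW // truncnS_gt.
have [_ _ _ _ /(_ l) lA] := pS m; apply: lA; first exact: (lp m.+1).
have -> : m.+1%:R^-1 *: l = (m.+1%:R^-1 / t) *: (t *: l).
  by rewrite scalerA divfK ?gt_eqF.
apply: convex_star => //.
by rewrite divr_ge0 ?(ltW t0) //= ler_pdivrMr ?mul1r.
Qed.

(** If [A / m] is dense in [W] near [w0 / m], averaging [A] with a point of [A]
    on the half-line of [- w0] makes it dense near [0]. *)
Lemma absorbing_closure_nbhs (W A : set V) :
  closed W -> is_subspace W -> convex_set A -> A 0 ->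
  (forall w, W w -> exists2 t : R, 0 < t & A (t *: w)) ->
  exists2 U, nbhs 0 U & forall w, U w -> W w -> closure A w.
Proof.
move=> cW WP cA A0 Aabs; have [W0 Wlin] := WP.
have [m [w0 [e [Ww0 e0 eA]]]] := absorbing_closure_interior cW WP cA A0 Aabs.
have WZ (t : R) w : W w -> W (t *: w).
  by move=> Ww; rewrite -[t *: w]addr0; exact: Wlin.
have [s s0 As] := Aabs _ (WZ (-1) _ Ww0).
have m0 : 0 < m.+1%:R :> R by rewrite ltr0n.
(* [a] and [b] are the weights for which [w0] cancels: [a / m.+1 = b s = c] *)
pose den := 1 + s * m.+1%:R.
have den0 : 0 < den by rewrite addr_gt0 ?mulr_gt0.
pose a := s * m.+1%:R / den; pose b := den^-1; pose c := s / den.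
have c0 : 0 < c by rewrite divr_gt0.
have ab : a + b = 1 by rewrite /a /b -[X in _ + X]mul1r -mulrDl addrC divff ?gt_eqF.
exists [set v | n (c^-1 *: v + w0 - w0) < e].
  apply: (nbhs_scale_shift (U := [set v | n (v - w0) < e])).
  by rewrite scaler0 add0r; exact: fnorm_ball.
move=> v /= ve Wv.
have vA : closure A (m.+1%:R^-1 *: (c^-1 *: v + w0)).
  by apply: eA => //; exact: Wlin.
have -> : v = a *: (m.+1%:R^-1 *: (c^-1 *: v + w0)) + b *: (s *: (-1 *: w0)).
  have -> : a *: (m.+1%:R^-1 *: (c^-1 *: v + w0)) = c *: (c^-1 *: v + w0).
    by rewrite scalerA /a /c mulrAC mulfK ?gt_eqF.
  rewrite scalerDr scalerA mulfV ?gt_eqF // scale1r.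
  by rewrite scalerA mulrC -/c scaleN1r scalerN addrK.
apply: closure_scale_shift vA => y Ay.
move/convex_setP: cA; apply => //.
  by rewrite /a divr_ge0 ?mulr_ge0 // ltW.
by rewrite invr_ge0 ltW.
Qed.

End FNorm.

(** * An open mapping theorem for closed convex relations *)

Section OpenProjection.
Context {R : realType} {X Z : tvsType R}.
Variables (nX : X -> R) (nZ : Z -> R).
Hypotheses (nXP : fnorm nX) (nZP : fnorm nZ).

Lemma small_convex_nbhs (V : tvsType R) (n : V -> R) (e : R) (U : set V) :
  fnorm n -> 0 < e -> nbhs 0 U ->
  exists W, [/\ nbhs 0 W, convex_set W, W `<=` U & forall v, W v -> n v < e].
Proof.
move=> nP e0 U0; have ball_e := fnorm_ball nP 0 e0.
have [W [W0 cW] WU] := convex_nbhs (filterI U0 ball_e).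
exists W; split=> // v Wv; first by case: (WU _ Wv).
by case: (WU _ Wv) => _; rewrite /= subr0.
Qed.

(** The points of [W] near [0] are so far only limits of projections of points of
    [B]. To reach [z] exactly, write it as the sum of the series of the
    [2^-(k+1) z_k] with [(x_k, z_k)] in [B]: the remainder multiplied by [2^k] is
    [y_k], and [z_k] is chosen so close to [2 y_k] that [y_k.+1 = 2 y_k - z_k] is
    small again. Density is available with [x_k] in any neighbourhood of [0], so
    the series of the [2^-(k+1) x_k] converges as well. The partial sums are in
    [B] by convexity, and their limit is in [B] because [B] is closed. *)
Lemma open_projection0 (W : set Z) (B : set (X * Z)) :
  closed W -> is_subspace W -> closed B -> convex_set B -> B 0 ->
  (forall x z, B (x, z) -> W z) ->
  (forall w, W w -> exists2 t : R, 0 < t & exists x, B (x, t *: w)) ->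
  exists2 U, nbhs 0 U & forall w, U w -> W w -> exists x, B (x, w).
Proof.
move=> cW WP cB convB B0 BW Babs; have [_ Wlin] := WP.
have BP := (convex_setP B).1 convB.
have W0 : W 0 by case: WP.
have WZ (t : R) u : W u -> W (t *: u).
  by move=> Wu; rewrite -[_ *: _]addr0; exact: Wlin.
pose A (V : set X) : set Z := [set z | exists2 x, V x & B (x, z)].
(* restricting the first component to [V] leaves the projection absorbing *)
have A_closure V : nbhs 0 V -> convex_set V ->
    exists2 U, nbhs 0 U & forall w, U w -> W w -> closure (A V) w.
  move=> V0 /[dup] convV /convex_setP VP.
  apply: (absorbing_closure_nbhs nZP) => //.
  - apply/convex_setP => z z' a b [x Vx Bx] [x' Vx' Bx'] a0 b0 ab.
    by exists (a *: x + b *: x'); [exact: VP|exact: (BP _ _ a b Bx Bx')].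
  - by exists 0 => //; exact: nbhs_singleton.
  - move=> w Ww; have [t t0 [x Bx]] := Babs _ Ww.
    have [e e0 eV] := nbhs_segment x V0.
    pose s := Num.min (e / 2) 1.
    have s0 : 0 < s by rewrite lt_min divr_gt0 //=.
    exists (s * t); first by rewrite mulr_gt0.
    exists (s *: x).
      rewrite -[_ *: _]add0r; apply: eV; rewrite gtr0_norm // gt_min.
      by rewrite ltr_pdivrMr // ltr_pMr // ltr1n.
    rewrite -scalerA; apply: (convex_star convB B0 _ Bx).
    by rewrite (ltW s0) /= ge_min lexx orbT.
have /choice[VN VNP] k : exists VN : set X * set Z,
    [/\ convex_set VN.1, VN.1 0, forall x, VN.1 x -> nX x < half k &
     [/\ nbhs 0 VN.2, convex_set VN.2, forall z, VN.2 z -> nZ z < half k &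
      forall w, VN.2 w -> W w -> closure (A VN.1) w]].
  have [V [V0 convV _ Vk]] := small_convex_nbhs nXP (half_gt0 R k) filterT.
  have [U U0 UA] := A_closure V V0 convV.
  have [N [N0 convN NU Nk]] := small_convex_nbhs nZP (half_gt0 R k) U0.
  exists (V, N); split => //=; first exact: nbhs_singleton.
  by split => // w /NU; exact: UA.
pose V k := (VN k).1; pose N k := (VN k).2.
have /choice[b bP] (q : nat * Z) : exists p : X * Z, W q.2 -> N q.1 (2 *: q.2) ->
    [/\ V q.1 p.1, B p & N q.1.+1 (2 *: (2 *: q.2 - p.2))].
  case: q => k y /=; have [Wy|nW] := pselect (W y); last by exists 0.
  have [Ny|nN] := pselect (N k (2 *: y)); last by exists 0.
  have [_ _ _ [_ _ _ /(_ (2 *: y) Ny)]] := VNP k.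
  have [_ _ _ [N0 _ _ _]] := VNP k.+1.
  have W2y : W (2 *: y) by exact: WZ.
  have : nbhs (2 *: y) [set z | N k.+1 (- 2 *: z + 2 *: (2 *: y))].
    by apply: nbhs_scale_shift; rewrite scaleNr addNr.
  move=> Nnbhs /(_ W2y _ Nnbhs) [z [[x Vx Bx] /= Nz]].
  by exists (x, z) => _ _; split => //=; rewrite scalerBr addrC -scaleNr.
exists [set z | N 0%N (2 *: z + 0)].
  by apply: nbhs_scale_shift; rewrite scaler0 addr0; case: (VNP 0%N) => _ _ _ [].
move=> z /=; rewrite addr0 => N0z Wz.
pose y := fix y k := if k is k'.+1 then 2 *: y k' - (b (k', y k')).2 else z.
have yP k : W (y k) /\ N k (2 *: y k).
  elim: k => [//|k [Wy Ny]] /=.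
  have [_ Bb Nb] := bP (k, y k) Wy Ny; split => //.
  apply: Wlin => //; rewrite -scaleN1r; apply: WZ.
  by apply: (BW (b (k, y k)).1); rewrite -surjective_pairing.
have bkP k := bP (k, y k) (yP k).1 (yP k).2.
pose S := fix S k :=
  if k is k'.+1 then S k' + half k'.+1 *: b (k', y k') else (0 : X * Z).
(* for [p = 0] this says that the partial sums are in [B] *)
have S_B k p : B p -> B (S k + half k *: p).
  elim: k p => [|k IHk] p Bp /=; first by rewrite add0r expr0 scale1r.
  rewrite -addrA exprSr -!scalerA -!scalerDr; apply: IHk.
  have [_ Bb _] := bkP k; rewrite scalerDr; apply: (BP) => //; rewrite ?invr_ge0 //.
  by rewrite [RHS]splitr div1r.
have S_z k : (S k).2 = z - half k *: y k.
  elim: k => [|k IHk] /=; first by rewrite expr0 scale1r subrr.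
  rewrite IHk scalerBr scalerA [half k.+1 * 2]mulrC -halfS.
  by rewrite opprB addrCA addrC.
have half01 k : 0 <= (half k : R) <= 1.
  by rewrite ltW ?half_gt0 // exprn_ile1 // ?invr_ge0 // invf_le1 // ler1n.
have [|x Sx] := fnorm_cvg nXP (u := fun k => (S k).1).
  move=> k; have [Vb _ _] := bkP k; have [convV V0 Vk _] := VNP k.
  rewrite [(S k.+1).1](_ : _ = (S k).1 + half k.+1 *: (b (k, y k)).1) //.
  by rewrite addrC addKr; apply/ltW/Vk; exact: convex_star.
have Sz : (fun k => (S k).2) @ \oo --> z.
  move=> U /(fnorm_nbhs nZP)[e e0 eU]; have [K KP] := half_lt e0.
  exists K => // k Kk; apply: eU; rewrite S_z addrC addKr (fnormN nZP).
  apply: lt_trans (KP k Kk); have [_ _ _ [N0 convN Nk _]] := VNP k.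
  have -> : half k *: y k = half k.+1 *: (2 *: y k).
    by rewrite scalerA mulrC -halfS.
  apply: Nk.
  by apply: convex_star => //; [exact: nbhs_singleton|exact: (yP k).2].
exists x.
have S_cvg : (fun k => ((S k).1, (S k).2)) @ \oo --> (x, z) by exact: cvg_pair.
have near_B : \forall k \near \oo, B ((S k).1, (S k).2).
  exists 0%N => // k _; rewrite -surjective_pairing.
  by have := S_B k 0 B0; rewrite scaler0 addr0.
exact: (@closed_cvg _ _ _ _ (fun k => ((S k).1, (S k).2)) B cB near_B _ S_cvg).
Qed.

Lemma open_projection (W : set Z) (B : set (X * Z)) x0 :
  closed W -> is_subspace W -> closed B -> convex_set B -> B (x0, 0) ->
  (forall x z, B (x, z) -> W z) ->
  (forall w, W w -> exists2 t : R, 0 < t & exists x, B (x, t *: w)) ->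
  exists2 U, nbhs 0 U & forall w, U w -> W w -> exists x, B (x, w).
Proof.
move=> cW WP cB /convex_setP convB B0 BW Babs.
pose B' : set (X * Z) := [set p | B (1 *: p + (x0, 0))].
have B'E x z : B' (x, z) <-> B (x + x0, z).
  rewrite /B' /= scale1r [X in B X](_ : _ = (x + x0, z)) //.
  by congr pair => /=; rewrite addr0.
have [||||w Ww|U U0 UB] := @open_projection0 W B' cW WP.
- apply: preimage_closed cB => p _; exact: scale_shift_continuous.
- apply/convex_setP => p q a b Bp Bq a0 b0 ab.
  have := convB _ _ a b Bp Bq a0 b0 ab; rewrite /B' /= !scale1r !scalerDr.
  by rewrite addrACA -scalerDl ab scale1r.
- by rewrite /B' /= scaler0 add0r.
- by move=> x z /B'E; exact: BW.
- have [t t0 [x Bx]] := Babs _ Ww; exists t => //; exists (x - x0).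
  by apply/B'E; rewrite subrK.
by exists U => // w Uw Ww; have [x /B'E Bx] := UB _ Uw Ww; exists (x + x0).
Qed.

End OpenProjection.

(** * Weak suprema *)

Section WeakSupremum.
Context {R : realType} {Y : tvsType R} (K : set Y).
Hypotheses (K_convex : convex_set K) (K_cone : is_cone K).

Lemma wlt_Fin (a b : Y) : wlt K (Fin a) (Fin b) <-> K° (b - a).
Proof.
split=> [[k Kk kE]|Kba]; first by rewrite -opprB -kE opprK.
by exists (b - a); rewrite ?opprB.
Qed.

Lemma interior_cone_trans (x y z : Y) : K° (x - y) -> K (y - z) -> K° (x - z).
Proof. by move=> Kxy Kyz; rewrite -(subrKA y); exact: interior_coneD. Qed.

(** Every line directed by an interior point of [K] meets the weak supremum of
    a set bounded by [b]: at the last point of the line that is a limit of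
    points below some element of the set. *)
Lemma WSup_on_line (M : set (augmented Y)) (e b y v0 : Y) :
  K° e -> ~ M PInf -> M (Fin v0) -> (forall v, M (Fin v) -> ~ K° (v - b)) ->
  exists t : R, [/\ WSup K M (Fin (y + t *: e)),
    (forall v, M (Fin v) -> ~ K° (v - y)) -> t <= 0 &
    M (Fin y) -> 0 <= t].
Proof.
move=> Ke MPInf Mv0 Mb.
pose T : set R := [set t | exists2 v, M (Fin v) & K° (v - (y + t *: e))].
have below x : exists2 t : R, 0 < t & K° (x + t *: e).
  have [s s0 Ks] := interior_cone_segment x Ke.
  exists s^-1; rewrite ?invr_gt0 // addrC.
  rewrite -[x]scale1r -(mulVf (lt0r_neq0 s0)) -scalerA -scalerDr.
  by apply: interior_coneZ; rewrite ?invr_gt0.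
have T0 : T !=set0.
  have [t t0 Kt] := below (v0 - y); exists (- t), v0 => //.
  by rewrite scaleNr opprD opprK addrA.
have Tb : has_ubound T.
  have [s s0 Ks] := below (y - b); exists s => t [v Mv Kt].
  rewrite leNgt; apply/negP => st; apply: (Mb v Mv).
  apply: interior_cone_trans Kt _.
  have -> : y + t *: e - b = (y - b + s *: e) + (t - s) *: e.
    by rewrite scalerBl addrACA subrr addr0 addrAC.
  apply: coneD => //; first exact: interior_subset.
  by apply: K_cone; [rewrite subr_ge0 ltW|exact: interior_subset].
have Tsup : has_sup T by [].
exists (sup T); split; first split.
- move=> [v Mv|/MPInf//|_ []] /wlt_Fin Kv.
  have [s s0 Ks] := interior_cone_segment (- e) Kv.
  have /(ub_le_sup Tb) : T (sup T + s).
    by exists v => //; rewrite scalerDl addrA [_ + s *: e]addrC opprD addrCA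
      addrC -scalerN.
  by rewrite leNgt ltrDl s0.
- move=> [a|//|_]; last by exists (Fin v0).
  move=> /wlt_Fin Ka; have [s s0 Ks] := interior_cone_segment (- e) Ka.
  have [t [v Mv Kt] st] := sup_adherent s0 Tsup.
  exists (Fin v) => //; apply/wlt_Fin.
  apply: interior_cone_trans Kt _.
  have -> : y + t *: e - a =
      (y + sup T *: e - a + s *: - e) + (t - (sup T - s)) *: e.
    rewrite scalerN !scalerBl addrACA -opprD [s *: e + _]addrC subrK.
    by rewrite [LHS]addrAC [RHS]addrAC (addrAC (y + _)) addrK.
  apply: coneD => //; first exact: interior_subset.
  by apply: K_cone; [rewrite subr_ge0 ltW|exact: interior_subset].
- move=> My; apply: ge_sup => // t [v Mv Kt]; rewrite leNgt; apply/negP => t0.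
  apply: (My v Mv).
  apply: interior_cone_trans Kt _; rewrite addrC addKr.
  by apply: K_cone; [exact: ltW|exact: interior_subset].
- move=> My; rewrite leNgt; apply/negP => t0.
  have /(ub_le_sup Tb) : T (sup T / 2).
    exists y => //; rewrite opprD addrA subrr add0r -scaleNr.
    by apply: interior_coneZ => //; rewrite oppr_gt0 pmulr_llt0 // invr_gt0.
  by lra.
Qed.

End WeakSupremum.

(** * The two optimality conditions for a given multiplier *)

Lemma epiP (R : realType) (V W : tvsType R) (K : set W) (F : V -> augmented W)
    (x : V) (w : W) :
  epi K F (x, w) <-> exists2 v, F x = Fin v & K (w - v).
Proof.
split=> [[_ ->] [_ [k Kk <-]]|[v Fv Kv]] /=.
  by case: (F x) => [v|//|//] [<-]; exists v; rewrite // addrC addKr.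
exists (F x) => //; exists (Fin (w - v)); first by exists (w - v).
by rewrite Fv /= addrC subrK.
Qed.

Section MultiplierConditions.
Context {R : realType} {X Y Z : tvsType R}.
Variables (K : set Y) (S : set Z) (C : set X).
Variables (F : X -> augmented Y) (G : X -> augmented Z) (xbar : X) (vbar : Y).
Hypotheses (K_convex : convex_set K) (K_cone : is_cone K).
Hypotheses (K_int : K° !=set0) (S0 : S 0) (F_proper : ~ range F NInf).
Hypotheses (xbar_feasible : feasible S C G xbar) (Fxbar : F xbar = Fin vbar).
Implicit Types T : continuous_linear Z Y.

Definition weak_lagrangian T := forall x v g s,
  C x -> F x = Fin v -> G x = Fin g -> S s -> ~ K° (T (- s) - (v + T g - vbar)).

Lemma weak_lagrangianP T : weak_lagrangian T <->
  forall x, C x ->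
    ~ (Fin @` [set t - k | t in T @` opp_set S & k in K°])
        (F x + comp_clin T G x - F xbar)%X.
Proof.
rewrite Fxbar; split=> [TP x Cx|TP x v g s Cx Fx Gx Ss Ks].
  rewrite /comp_clin; case Fx : (F x) => [v||]; case Gx : (G x) => [g||];
    move=> [u /= [_ [_ [s Ss <-] <-] [k Kk kE]]] // [uE].
  apply: (TP x v g s) => //; rewrite -uE -kE.
  by rewrite opprB addrCA subrr addr0.
apply: (TP x Cx); rewrite /comp_clin Fx Gx /=.
exists (v + T g - vbar) => //; exists (T (- s)).
  by exists (- s) => //; exists s.
by exists (T (- s) - (v + T g - vbar)) => //; rewrite subKr.
Qed.

Lemma weak_solutionP : weak_solution K S C F G xbar <->
  forall x v, feasible S C G x -> F x = Fin v -> ~ K° (vbar - v).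
Proof.
split=> [[_ [_ [xbar_min _]]] x v Ax Fx Kv|xbar_min].
  apply: (xbar_min (Fin v)); first by exists x.
  by rewrite Fxbar; exact/wlt_Fin.
split=> //; split; first by exists xbar.
split=> [_ [x Ax <-]|w barw]; last by exists (F xbar) => //; exists xbar.
rewrite Fxbar; case Fx : (F x) => [v||].
- by move/wlt_Fin; exact: xbar_min Fx.
- by [].
- by case: F_proper; exists x.
Qed.

Lemma weak_lagrangian_sufficient T :
  weak_lagrangian T -> weak_solution K S C F G xbar.
Proof.
move=> TP; apply/weak_solutionP => x v [Cx [_ [s Ss <-] Gx]] Fx Kv.
apply: (TP x v (- s) s) => //.
by rewrite opprB addrC opprD addrA subrK.
Qed.

(** Let [M1] be the set of the values of [T] on [- S], and [M2] that of the
    opposites of the values of the Lagrangian [F + T \o G] on [C]; then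
    [weak_lagrangian T] says that no [- vbar - t] with [t] in [M1] is below an
    element of [M2]. A weak supremum [a] of [M1] is a limit of points below [M1],
    so [- vbar - a] is not below [M2] either, and going down from it one meets
    the weak supremum of [M2]. Conversely, going up from [t] one meets a weak
    supremum of [M1], to which the inclusion applies. *)
Lemma weak_lagrangian_conjugate T : Lplusw S K T ->
  weak_lagrangian T <->
  eadd_set [set (- F xbar)%X] (eopp @` conjugate K (indicator (opp_set S)) T)
    `<=` eadd_set
      (conjugate K (fun x => F x + indicator C x + comp_clin T G x)%X
         (@clin0 R X Y))
      (Fin @` K).
Proof.
move=> TL; rewrite Fxbar /conjugate.
set M1 := (X in eopp @` WSup K X); set M2 := (X in eadd_set (WSup K X)).
have [e Ke] := K_int.
have M1E v : M1 (Fin v) <-> exists2 s, S s & v = T (- s).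
  split=> [[z _]|[s Ss ->]].
    rewrite /indicator; case: ifPn => [|_ //].
    by rewrite inE => -[s Ss <-] [<-]; exists s; rewrite //= subr0.
  exists (- s) => //; rewrite /indicator ifT /= ?subr0 //.
  by rewrite inE; exists s.
have M1PInf : ~ M1 PInf by move=> [z _]; rewrite /indicator; case: ifP.
(* [Lplusw] makes [0] a bound of [M1] for the weak order *)
have T_nint s : S s -> ~ K° (T (- s)).
  move=> Ss KT; suff : ((T @` S) `&` opp_set K°) (T s) by rewrite TL.
  by split; [exists s|exists (T (- s)); rewrite // linearN opprK].
have M2E v : M2 (Fin v) <-> exists x f g,
    [/\ C x, F x = Fin f, G x = Fin g & v = - (f + T g)].
  split=> [[x _]|[x [f [g [Cx Fx Gx ->]]]]].
    rewrite /comp_clin /indicator; case: ifPn => [|_]; last first.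
      by case: (F x); case: (G x).
    rewrite inE => Cx; case Fx : (F x) => [f||] //; case Gx : (G x) => [g||] //.
    by move=> [<-]; exists x, f, g; rewrite addr0 add0r.
  exists x => //; rewrite /comp_clin /indicator ifT ?inE // Fx Gx /=.
  by rewrite addr0 add0r.
have M2PInf : ~ M2 PInf.
  move=> [x _]; rewrite /comp_clin /indicator.
  case Fx : (F x) => [f||]; case: ifP => _; case Gx : (G x) => [g||] // _;
    by apply: F_proper; exists x.
have M2bar : exists m, M2 (Fin m).
  have [Cbar [gbar _ Gbar]] := xbar_feasible.
  by exists (- (vbar + T gbar)); apply/M2E; exists xbar, vbar, gbar.
have below_M2 : weak_lagrangian T -> forall s m, S s -> M2 (Fin m) ->
    ~ K° (m - (- vbar - T (- s))).
  move=> TP s m Ss /M2E[x [f [g [Cx Fx Gx ->]]]] Km; apply: (TP x f g s) => //.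
  suff <- : - (f + T g) - (- vbar - T (- s)) = T (- s) - (f + T g - vbar) by [].
  by rewrite (opprB (- vbar)) opprB opprK addrC addrA.
split=> [TP _ [_ -> [_ [a aWSup <-] <-]]|TI x f g s Cx Fx Gx Ss Ks].
- have [a_ub a_lim] := aWSup.
  case: a aWSup a_ub a_lim => [a||] aWSup a_ub a_lim.
  + have a_up m : M2 (Fin m) -> ~ K° (m - (- vbar - a)).
      move=> Mm Km; have [t t0 Kt] := interior_cone_segment (- e) Km.
      have [|u M1u au] := a_lim (Fin (a - t *: e)).
        by apply/wlt_Fin; rewrite subKr; exact: interior_coneZ.
      case: u M1u au => [u|//|//] /M1E[s Ss ->] /wlt_Fin Ku.
      apply: (below_M2 TP s m Ss Mm).
      have -> : m - (- vbar - T (- s)) =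
          (m - (- vbar - a) + t *: - e) + (T (- s) - (a - t *: e)).
        have E c : m - (- vbar - c) = m + vbar + c.
          by rewrite opprB opprK [c + _]addrC addrA.
        by rewrite !E scalerN opprB [T _ + (_ - _)]addrC addrA subrKA addrK.
      apply: interior_coneD => //; exact: interior_subset.
    have [m0 Mm0] := M2bar.
    have [t [tWSup t_le0 _]] :=
      WSup_on_line K_convex K_cone (- vbar - a) Ke M2PInf Mm0 a_up.
    exists (Fin (- vbar - a + t *: e)) => //.
    exists (Fin (- t *: e)).
      exists (- t *: e) => //; apply: K_cone; last exact: interior_subset.
      by rewrite oppr_ge0 t_le0.
    by rewrite /= -addrA -scalerDl subrr scale0r addr0.
  + have [//|u M1u u0] := a_lim (Fin 0).
    case: u M1u u0 => [u|//|//] /M1E[s Ss ->] /wlt_Fin.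
    by rewrite subr0 => /(T_nint _ Ss).
  + by case: (a_ub (Fin 0)) => //; apply/M1E; exists 0; rewrite // oppr0 linear0.
- have M1s : M1 (Fin (T (- s))) by apply/M1E; exists s.
  have M1b v : M1 (Fin v) -> ~ K° (v - 0).
    by move=> /M1E[s' Ss' ->]; rewrite subr0; exact: T_nint.
  have [t [tWSup _ /(_ M1s) t0]] :=
    WSup_on_line K_convex K_cone (T (- s)) Ke M1PInf M1s M1b.
  have [|[w||] [w_ub _] [_ [k Kk <-]] //= [wk]] :=
    TI (Fin (- vbar - (T (- s) + t *: e))).
    exists (Fin (- vbar)) => //; exists (Fin (- (T (- s) + t *: e))) => //.
    by exists (Fin (T (- s) + t *: e)).
  have M2m : M2 (Fin (- (f + T g))) by apply/M2E; exists x, f, g.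
  apply: (w_ub _ M2m); apply/wlt_Fin.
  have -> : - (f + T g) - w = (T (- s) - (f + T g - vbar)) + (t *: e + k).
    have -> : w = (- vbar - (T (- s) + t *: e)) - k by rewrite -wk addrK.
    rewrite !opprB opprK [RHS]addrACA addrA addrCA.
    by rewrite addrC; congr (_ + _); rewrite addrC addrA.
  apply: interior_coneD => //; apply: coneD => //; apply: K_cone => //.
  exact: interior_subset.
Qed.

End MultiplierConditions.

(** * Scalarization and constraint qualifications *)

Section ConstraintQualification.
Context {R : realType} {X Y Z : tvsType R}.
Variables (K : set Y) (S : set Z) (C : set X).
Variables (F : X -> augmented Y) (G : X -> augmented Z) (xbar : X) (vbar : Y).
Hypotheses (K_convex : convex_set K) (K_cone : is_cone K) (S_cone : is_cone S).
Hypothesis S_convex : convex_set S.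
Hypotheses (K0 : K 0) (C_convex : convex_set C).
Hypothesis F_proper : ~ range F NInf.
Hypotheses (F_convex : cone_convex K F) (G_convex : cone_convex S G).
Hypotheses (xbar_feasible : feasible S C G xbar) (Fxbar : F xbar = Fin vbar).

Lemma convex_comb_epi (V W : tvsType R) (D : set W) (f : V -> augmented W)
    (x x' : V) (w w' : W) (a b : R) : cone_convex D f ->
  epi D f (x, w) -> epi D f (x', w') -> 0 <= a -> 0 <= b -> a + b = 1 ->
  epi D f (a *: x + b *: x', a *: w + b *: w').
Proof. by move=> /convex_setP cf; exact: (cf (x, w) (x', w')). Qed.

Lemma epi_value x v : F x = Fin v -> epi K F (x, v).
Proof. by move=> Fx; apply/epiP; exists v; rewrite // subrr. Qed.

Lemma feasible_epi x : feasible S C G x <-> C x /\ epi S G (x, 0).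
Proof.
split=> [[Cx [_ [s Ss <-] Gx]]|[Cx /epiP[g Gx Sg]]].
  by split=> //; apply/epiP; exists (- s); rewrite // sub0r opprK.
split=> //; exists g; rewrite ?Gx //.
by exists (0 - g) => //; rewrite sub0r opprK.
Qed.

Lemma value_setP z : value_set S C F G z <->
  exists x v, [/\ C x, F x = Fin v & epi S G (x, z)].
Proof.
split=> [[_ [x [[Cx Fx] Gx] <-] [_ [s Ss <-] zE]]|[x [v [Cx Fx /epiP[g Gx Sg]]]]].
  case Fv : (F x) => [v||]; [|by []|by case: F_proper; exists x].
  exists x, v; split=> //; apply/epiP.
  case: (G x) zE => [g|//|//] [<-]; exists g => //.
  by rewrite addrC addKr.
exists (G x); first by exists x => //; split; rewrite /edom /= ?Fx ?Gx.
by exists (Fin (z - g)); [exists (z - g)|rewrite Gx /= addrC subrK].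
Qed.

(** The separated set contains all the [w - vbar] with [w] above [F x], hence [K]
    itself: this is what makes [y] nonnegative on [K]. *)
Lemma scalarization : K° !=set0 -> weak_solution K S C F G xbar ->
  exists y : continuous_linear Y R^o, [/\ forall k, K k -> 0 <= y k,
    forall k, K° k -> 0 < y k &
    forall x w, C x -> epi S G (x, 0) -> epi K F (x, w) -> y vbar <= y w].
Proof.
move=> K_int /(weak_solutionP K F_proper xbar_feasible Fxbar) xbar_min.
pose D : set Y :=
  [set d | exists x, [/\ C x, epi S G (x, 0) & epi K F (x, 1 *: d + vbar)]].
have cD : convex_set D.
  apply/convex_setP => d d' a b [x [Cx Gx Fx]] [x' [Cx' Gx' Fx']] a0 b0 ab.
  exists (a *: x + b *: x'); split.
  - by move/convex_setP: C_convex; apply.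
  - by have := convex_comb_epi G_convex Gx Gx' a0 b0 ab; rewrite !scaler0 addr0.
  - have := convex_comb_epi F_convex Fx Fx' a0 b0 ab.
    by rewrite !scale1r !scalerDr addrACA -scalerDl ab scale1r.
have [Cbar Gbar] := (feasible_epi xbar).1 xbar_feasible.
have KD : K `<=` D.
  move=> k Kk; exists xbar; split=> //; apply/epiP; exists vbar => //.
  by rewrite scale1r addrK.
have Dneg d : D d -> ~ K° (- d).
  move=> [x [Cx Gx /epiP[v Fx]]]; rewrite scale1r => Kv Kd.
  apply: (xbar_min x v _ Fx); first exact/feasible_epi.
  apply: (interior_cone_trans K_convex K_cone (y := d + vbar)) => //.
  by rewrite opprD addrCA subrr addr0.
have [y [yD yK]] := weak_separation K_convex K_cone K_int cD KD Dneg.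
exists y; split=> // [k /KD/yD //|x w Cx Gx Fw].
rewrite -subr_ge0 -linearB; apply: yD; exists x; split=> //.
by rewrite scale1r subrK.
Qed.

Variable y : continuous_linear Y R^o.
Hypothesis y_ge0 : forall k, K k -> 0 <= y k.
Hypothesis y_min :
  forall x w, C x -> epi S G (x, 0) -> epi K F (x, w) -> y vbar <= y w.

(** The set lying above the value function of the problem of minimizing
    [y \o F - y vbar] over the [x] in [C] with [G x - z] in [- S]. Both epigraphs
    appear, instead of the values of [F] and [G], so that convexity is
    inherited. *)
Definition value_epigraph : set (Z * R^o) :=
  [set p | exists x w, [/\ C x, epi K F (x, w), epi S G (x, p.1) &
                           y w - y vbar <= p.2]].

Lemma convex_value_epigraph : convex_set value_epigraph.
Proof.
apply/convex_setP => -[z r] [z' r'] a b [x [w [Cx Fw Gz yw]]].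
move=> [x' [w' [Cx' Fw' Gz' yw']]] a0 b0 ab.
exists (a *: x + b *: x'), (a *: w + b *: w'); split.
- by move/convex_setP: C_convex; apply.
- exact: convex_comb_epi.
- exact: convex_comb_epi Gz Gz' a0 b0 ab.
- have -> : y (a *: w + b *: w') - y vbar =
      a * (y w - y vbar) + b * (y w' - y vbar).
    by rewrite linearD !functionalZ !mulrBr addrACA -opprD -mulrDl ab mul1r.
  by apply: lerD; exact: ler_wpM2l.
Qed.

Lemma value_epigraph_ge0 r : value_epigraph (0, r) -> 0 <= r.
Proof.
move=> [x [w [Cx Fw Gz yw]]]; apply: le_trans yw.
by rewrite subr_ge0; exact: y_min Gz Fw.
Qed.

Lemma value_epigraph_value_set z r :
  value_epigraph (z, r) -> value_set S C F G z.
Proof.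
by move=> [x [w [Cx /epiP[v Fx _] Gz _]]]; apply/value_setP; exists x, v.
Qed.

Lemma value_set_value_epigraph z :
  value_set S C F G z -> exists r, value_epigraph (z, r).
Proof.
move=> /value_setP[x [v [Cx Fx Gz]]]; exists (y v - y vbar), x, v.
by split => //; exact: epi_value.
Qed.

Definition has_multiplier := exists l : continuous_linear Z R^o,
  forall z r, value_epigraph (z, r) -> l z <= r.

(** The point [x0] remains feasible for every small perturbation, so its value
    bounds the value function near [0]. *)
Lemma slater_multiplier x0 : C x0 -> edom F x0 ->
  (Fin @` opp_set (S°)) (G x0) -> has_multiplier.
Proof.
move=> Cx0 Fx0 [_ [s Ss <-] Gx0].
case Fv : (F x0) => [v||]; [|by []|by case: F_proper; exists x0].
apply: (@subgradient_of_bounded _ _ _ setT [set z | S (1 *: z + s)]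
  (y v - y vbar)) => //.
- exact: convex_value_epigraph.
- exact: value_epigraph_ge0.
- by apply: nbhs_scale_shift; rewrite scaler0 add0r.
- move=> z; rewrite /= scale1r => Sz _; exists x0, v; split=> //.
    exact: epi_value.
  by apply/epiP; exists (- s); rewrite // opprK.
Qed.

(** Since [0] is in the relative interior of [E], the cone spanned by the value
    epigraph projects onto the span of [E], and so its preimage under the
    projection [P] projects onto [Z]. The functional obtained vanishes on the
    kernel of [P], hence factors through [P] and is continuous. *)
Lemma finite_dim_multiplier : hausdorff_space Z ->
  finite_dim (lin (value_set S C F G)) -> ri (value_set S C F G) 0 ->
  has_multiplier.
Proof.
set E := value_set S C F G => hZ [s linE] [E0 riE].
(* an affine set containing [0] is a subspace *)
have aff_subspace : is_subspace (aff E).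
  have affP : is_affine (aff E).
    move=> t u v Eu Ev A [AP EA]; apply: (AP); first exact: Eu.
    exact: Ev.
  have aff0 : aff E 0 by exact: sub_gen_smallest.
  split=> // t u v Eu Ev.
  have tu : aff E (t *: u).
    by have := affP t u 0 Eu aff0; rewrite scaler0 addr0.
  move: (t *: u) tu => w Ew.
  have := affP 2 _ 0 (affP 2^-1 _ _ Ew Ev) aff0.
  rewrite scaler0 addr0 scalerDr !scalerA mulfV // scale1r.
  by rewrite mulrBr mulfV // mulr1 [2 - 1](_ : _ = 1) ?scale1r //; lra.
have Eabs w : lin E w -> exists2 t : R, 0 < t & E (t *: w).
  move=> Ew; have affw : aff E w.
    by apply: (smallest_sub aff_subspace _ Ew); exact: sub_gen_smallest.
  have [e e0 eE] := nbhs_segment w riE.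
  exists (e / 2); first by rewrite divr_gt0.
  have := eE (e / 2); rewrite add0r; apply.
    by rewrite gtr0_norm ?divr_gt0 // ltr_pdivrMr // ltr_pMr // ltr1n.
  rewrite -[_ *: w]addr0; apply: aff_subspace.2 => //; exact: aff_subspace.1.
have [P [Ps sP cP]] := finite_dim_projection s hZ.
pose Q : set (Z * R^o) := [set p | conic_hull value_epigraph (P p.1, p.2)].
have [r0 H0] := value_set_value_epigraph E0.
have hull0 : conic_hull value_epigraph 0.
  by exists 0 => //=; exists (0, r0); rewrite ?scale0r.
have QP : bounding_cone Q.
  split.
  - by rewrite /Q /= linear0.
  - move=> [z r] [z' r'] Qz Qz'; rewrite /Q /= linearD.
    exact: (conic_hullD convex_value_epigraph Qz Qz').
  - move=> t [z r] t0 Qz; rewrite /Q /= linearZ.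
    exact: (conic_hullZ t0 Qz).
  - move=> r; rewrite /Q /= linear0 => -[t /= t0 [[w r'] Hw [tw <-]]].
    have [->|t_neq0] := eqVneq t 0; first by rewrite scale0r.
    rewrite mulr_ge0 //; apply: value_epigraph_ge0.
    by move/eqP: tw; rewrite scaler_eq0 (negbTE t_neq0) => /eqP <-.
have Qtot z : exists r, Q (z, r).
  have [|t t0 Et] := Eabs (P z); first by rewrite linE.
  have [r Hr] := value_set_value_epigraph Et.
  exists (t^-1 * r); exists t^-1; first by rewrite /= invr_ge0 ltW.
  exists (t *: P z, r : R^o) => //; congr pair.
  by rewrite /= scalerA mulVf ?gt_eqF // scale1r.
have [l lQ] := hahn_banach_cone QP Qtot.
have lP z : l z = l (P z).
  have ker u : P u = 0 -> l u <= 0.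
    by move=> Pu; apply: lQ; rewrite /Q /= Pu.
  have l_le u v : P u = P v -> l u <= l v.
    move=> Puv; rewrite -subr_le0 -(linearB l); apply: ker.
    by rewrite linearB Puv subrr.
  by apply/eqP; rewrite eq_le !l_le // (sP _ (Ps z)).
have cl : continuous l.
  rewrite (_ : (l : Z -> R^o) = l \o P); first exact: cP.
  by apply/funext => z /=; exact: lP.
exists (ContinuousLinear cl) => z r Hz; apply: lQ.
rewrite /Q /= sP; first exact: sub_conic_hull.
rewrite -linE; apply: sub_gen_smallest; exact: value_epigraph_value_set Hz.
Qed.

(** The relation [B] keeps the points where [y \o F] is at most [y vbar + 1]: it
    is closed by semicontinuity, and its projection still absorbs the closed
    subspace [W] spanned by [E], since a small step from [xbar] towards any point
    raises [y \o F] by at most [1]. By [open_projection] the value function is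
    at most [1] near [0] in [W]. *)
Lemma frechet_multiplier : frechet_space X -> frechet_space Z -> closed C ->
  lower_semicontinuous (comp_dual y F) -> epi_closed S G ->
  sqri (value_set S C F G) 0 -> has_multiplier.
Proof.
set E := value_set S C F G.
move=> /frechet_fnorm[nX nXP] /frechet_fnorm[nZ nZP] cC lscF cG [E0 WP cW].
set W := cone_at E 0 in WP cW.
have EW z : E z -> W z.
  by move=> Ez; exists 1 => //=; exists z; rewrite // subr0 scale1r.
pose B : set (X * Z) := [set p | [/\ C p.1,
  exists2 v, F p.1 = Fin v & y v <= y vbar + 1 & epi S G p]].
have cB : closed B.
  have -> : B = (fst @^-1` C `&`
      fst @^-1` ~` [set x | ((y vbar + 1)%:E < comp_dual y F x)%E]) `&` epi S G.
    apply/seteqP; split=> [[x z] [/= Cx [v Fx yv] Gz]|[x z] [[/= Cx Fx] Gz]].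
      split=> //; split=> //=; rewrite /comp_dual Fx lte_fin.
      by apply/negP; rewrite -leNgt.
    split=> //; move: Fx; rewrite /comp_dual.
    case: (F x) => [v||]; [|by rewrite ltry|by rewrite ltry].
    by rewrite lte_fin => /negP; rewrite -leNgt; exists v.
  apply: closedI => //; apply: closedI; apply: preimage_closed.
  - by move=> p _; exact: cvg_fst.
  - by [].
  - by move=> p _; exact: cvg_fst.
  - by apply: open_closedC; exact: ((lower_semicontinuousP _).1 lscF).
have F_comb x x' w w' a b : epi K F (x, w) -> epi K F (x', w') ->
    0 <= a -> 0 <= b -> a + b = 1 ->
    exists2 v, F (a *: x + b *: x') = Fin v & y v <= a * y w + b * y w'.
  move=> Fw Fw' a0 b0 ab.
  have /epiP[v Fv Kv] := convex_comb_epi F_convex Fw Fw' a0 b0 ab.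
  exists v => //; rewrite -!functionalZ -linearD -subr_ge0 -linearB.
  exact: y_ge0.
have C_comb x x' a b : C x -> C x' -> 0 <= a -> 0 <= b -> a + b = 1 ->
    C (a *: x + b *: x').
  by move/convex_setP: C_convex; exact.
have convB : convex_set B.
  apply/convex_setP => -[x z] [x' z'] a b [Cx [v Fv yv] Gz] [Cx' [v' Fv' yv'] Gz'].
  move=> a0 b0 ab; split; [exact: C_comb| |exact: convex_comb_epi Gz Gz' _ _ _].
  have [v'' Fv'' yv''] :=
    F_comb _ _ _ _ _ _ (epi_value Fv) (epi_value Fv') a0 b0 ab.
  exists v'' => //; apply: le_trans yv'' _.
  have -> : y vbar + 1 = a * (y vbar + 1) + b * (y vbar + 1).
    by rewrite -mulrDl ab mul1r.
  by apply: lerD; exact: ler_wpM2l.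
have [Cbar Gbar] := (feasible_epi xbar).1 xbar_feasible.
have Bbar : B (xbar, 0) by split=> //; exists vbar; rewrite //= lerDl.
have BW x z : B (x, z) -> W z.
  by move=> [/= Cx [v Fx _] Gz]; apply/EW/value_setP; exists x, v.
have Babs w : W w -> exists2 t : R, 0 < t & exists x, B (x, t *: w).
  move=> [t /= t0 [z /value_setP[x [v [Cx Fx Gz]]] <-]]; rewrite subr0.
  have [->|t_neq0] := eqVneq t 0.
    by exists 1 => //; exists xbar; rewrite scale0r scaler0.
  have t_gt0 : 0 < t by rewrite lt_neqAle eq_sym t_neq0.
  pose d := y v - y vbar; pose s := (`|d| + 1)^-1.
  have d1 : 0 < `|d| + 1 by rewrite ltr_wpDl.
  have s_gt0 : 0 < s by rewrite invr_gt0.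
  have s_le1 : s <= 1 by rewrite invf_le1 // lerDr.
  have s'_ge0 : 0 <= 1 - s by rewrite subr_ge0.
  have ss : s + (1 - s) = 1 by rewrite addrC subrK.
  exists (s / t); first by rewrite divr_gt0.
  exists (s *: x + (1 - s) *: xbar); rewrite scalerA divfK //; split=> /=.
  - exact: C_comb (ltW s_gt0) _ _.
  - have [v' Fv' yv'] :=
      F_comb _ _ _ _ _ _ (epi_value Fx) (epi_value Fxbar) (ltW s_gt0) s'_ge0 ss.
    exists v' => //; apply: le_trans yv' _.
    have -> : s * y v + (1 - s) * y vbar = y vbar + s * d.
      by rewrite mulrBl mul1r addrCA mulrBr.
    rewrite lerD2l mulrC ler_pdivrMr // mul1r.
    by rewrite (le_trans (ler_norm d)) // lerDl.
  - have := convex_comb_epi G_convex Gz Gbar (ltW s_gt0) s'_ge0 ss.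
    by rewrite scaler0 addr0.
have [U U0 UB] := open_projection nXP nZP cW WP cB convB Bbar BW Babs.
apply: (@subgradient_of_bounded _ _ _ W U 1) => //.
- exact: convex_value_epigraph.
- exact: value_epigraph_ge0.
- by move=> z r /value_epigraph_value_set/EW.
- move=> z Uz Wz; have [x [/= Cx [v Fx yv] Gz]] := UB z Uz Wz.
  exists x, v; split=> //=; first exact: epi_value.
  by rewrite lerBlDl.
Qed.

(** For [T z = - l z *: e] with [e] interior to [K] and [y e = 1] one has
    [y (T z) = - l z]. Applying [y], a violation of the weak inequality by [x] and
    [s] would give [y (F x) - y vbar < l (G x + s)]. *)
Lemma multiplier_weak_lagrangian : K° !=set0 ->
  (forall k, K° k -> 0 < y k) -> has_multiplier ->
  exists2 T : continuous_linear Z Y, Lplusw S K T &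
    weak_lagrangian K S C F G vbar T.
Proof.
move=> [e Ke] y_gt0 [l lH]; have ye := y_gt0 _ Ke.
pose c := - (y e)^-1 *: e.
have yc : y c = -1 by rewrite functionalZ mulNr mulVf ?gt_eqF.
have f_linear : linear (fun z => l z *: c).
  move=> t u v /=; have -> : l (t *: u + v) = t * l u + l v by exact: linearP.
  by rewrite scalerDl -scalerA.
pose f : {linear Z -> Y} := HB.pack (fun z => l z *: c)
  (GRing.isLinear.Build R Z Y *:%R (fun z => l z *: c) f_linear).
have cf : continuous f.
  move=> z; apply: (@continuous_comp Z (R^o * Y)%type Y
    (fun z => (l z, c)) (fun p => p.1 *: p.2)); last exact: scale_continuous.
  apply: (@cvg_pair _ _ _ _ (nbhs (l z : R^o))); last exact: cvg_cst.
  exact: clin_continuous.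
pose T := ContinuousLinear cf.
have yT z : y (T z) = - l z by rewrite functionalZ yc mulrN1.
have [Cbar Gbar] := (feasible_epi xbar).1 xbar_feasible.
have l_le0 s : S s -> l s <= 0.
  move=> Ss; apply: lH; exists xbar, vbar; split=> //=.
  - exact: epi_value.
  - move/epiP: Gbar => [g Gx Sg]; apply/epiP; exists g => //.
    by rewrite -[s]addr0 -addrA; exact: coneD.
  - by rewrite subrr.
exists T.
- rewrite /Lplusw /=; rewrite -subset0 => _ [[s Ss <-] [k Kk kE]].
  have := y_gt0 _ Kk; rewrite -[k]opprK linearN kE [y _]yT opprK.
  by rewrite ltNge l_le0.
- move=> x v g s Cx Fx Gx Ss /y_gt0.
  rewrite (linearB y) (linearB y) (linearD y) !yT linearN opprK.
  have : l (g + s) <= y v - y vbar.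
    apply: lH; exists x, v; split=> //=; first exact: epi_value.
    by apply/epiP; exists g; rewrite // addrC addKr.
  by rewrite linearD; lra.
Qed.

End ConstraintQualification.

(** * The theorem *)

Theorem theorem5p4 (R : realType) (X Y Z : tvsType R)
    (hX : hausdorff_space X) (hY : hausdorff_space Y) (hZ : hausdorff_space Z)
    (K : set Y) (K_closed : closed K) (K_pointed : pointed_cone K)
    (K_convex : convex_set K) (K_cone : is_cone K) (K_int : K° !=set0)
    (S : set Z) (S_nonempty : S !=set0) (S_closed : closed S)
    (S_convex : convex_set S) (S_cone : is_cone S)
    (C : set X) (C_nonempty : C !=set0) (C_convex : convex_set C)
    (F : X -> augmented Y) (F_proper : proper_map F) (F_convex : cone_convex K F)
    (G : X -> augmented Z) (G_proper : proper_map G) (G_convex : cone_convex S G)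
    (xbar : X) (xbar_feasible : feasible S C G xbar)
    (xbar_dom : edom F xbar)
    (constraint_qualification :
      (exists x0, (C `&` edom F) x0 /\ (Fin @` opp_set (S°)) (G x0))
      \/ [/\ [/\ frechet_space X, frechet_space Z & closed C],
             forall y : continuous_linear Y R^o,
               lower_semicontinuous (comp_dual y F),
             epi_closed S G & sqri (value_set S C F G) 0]
      \/ finite_dim (lin (value_set S C F G)) /\ ri (value_set S C F G) 0) :
  (weak_solution K S C F G xbar <->
    exists2 T : continuous_linear Z Y, Lplusw S K T &
      eadd_set [set (- F xbar)%X]
               (eopp @` conjugate K (indicator (opp_set S)) T)
      `<=` eadd_set
             (conjugate K (fun x => F x + indicator C x + comp_clin T G x)%X
                        (@clin0 R X Y))
             (Fin @` K))
  /\
  (weak_solution K S C F G xbar <->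
    exists2 T : continuous_linear Z Y, Lplusw S K T &
      forall x, C x ->
        ~ (Fin @` [set t - k | t in T @` opp_set S & k in K°])
            (F x + comp_clin T G x - F xbar)%X).
Proof.
have [F_dom F_NInf] := F_proper; have [G_dom G_NInf] := G_proper.
have [vbar Fxbar] : exists vbar, F xbar = Fin vbar.
  move: xbar_dom; rewrite /edom /=; case Fx : (F xbar) => [v||] // _.
    by exists v.
  by case: F_NInf; exists xbar.
have K0 : K 0.
  have [e Ke] := K_int; rewrite -(scale0r e).
  by apply: K_cone => //; exact: interior_subset.
have S0 : S 0 by have [s Ss] := S_nonempty; rewrite -(scale0r s); exact: S_cone.
have necessary : weak_solution K S C F G xbar ->
    exists2 T : continuous_linear Z Y, Lplusw S K T &
      weak_lagrangian K S C F G vbar T.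
  move=> /(scalarization K_convex K_cone C_convex F_NInf F_convex G_convex
    xbar_feasible Fxbar K_int)[y [y_ge0 y_gt0 y_min]].
  suff mult : has_multiplier K S C F G vbar y.
    exact: (multiplier_weak_lagrangian S_cone S_convex K0 xbar_feasible Fxbar
      K_int y_gt0 mult).
  case: constraint_qualification => [[x0 [[Cx0 Fx0] Gx0]]|].
    exact: slater_multiplier Cx0 Fx0 Gx0.
  case=> [[[frX frZ cC] lscF cG sqriE]|[fdE riE]].
    by apply: (frechet_multiplier K0 C_convex F_NInf F_convex G_convex
      xbar_feasible Fxbar).
  by apply: finite_dim_multiplier.
have sufficient T : weak_lagrangian K S C F G vbar T ->
    weak_solution K S C F G xbar.
  exact: weak_lagrangian_sufficient.
have conjP T (TL : Lplusw S K T) := weak_lagrangian_conjugate K_convex K_cone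
  K_int S0 F_NInf xbar_feasible Fxbar TL.
have pointP T := weak_lagrangianP K S C G Fxbar T.
split; split.
- by move=> /necessary[T TL TP]; exists T => //; exact: (conjP T TL).1.
- by move=> [T TL TI]; apply: (sufficient T); exact: (conjP T TL).2.
- by move=> /necessary[T TL TP]; exists T => //; exact: (pointP T).1.
- by move=> [T TL TJ]; apply: (sufficient T); exact: (pointP T).2.
Qed.
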